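(* Let $n\ge2$ be even and let $\mathfrak{g}=\mathfrak{g}_{K_n}$ be the dynamical Lie algebra of QAOA-MaxCut on the complete graph $K_n$. Define (all exponents non-negative integers with $p+q+r\le n$) $$J_1=\{X^pY^qZ^r:p\text{ even},\ q,r\text{ odd}\}\setminus\{Y^1Z^1\},\qquad J_2=\{X^pY^1Z^r:p,r\text{ odd}\},$$ $$J_3=\{X^pY^qZ^r:p,q,r\text{ odd},\ q\ge3\},\qquad J_4=\{X^pY^qZ^r:p\text{ odd},\ q,r\text{ even}\},\qquad J_5=\{Z^2,Y^2,Y^1Z^1\},$$ $$L_1=\{[X^1,v]:v\in J_1\},\qquad L_2=\{[Z^2,v]:v\in J_2\}.$$ Then $R=\bigcup_{k=1}^5J_k\cup L_1\cup L_2$ is a basis for $\mathfrak{g}$, and $\dim(\mathfrak{g})=\frac1{12}(n^3+6n^2+2n+12)$.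
   Context: $X_j,Y_j,Z_j$ are the Pauli matrices acting on qubit $j\in[n]$. $\mathfrak{g}_{K_n}\subseteq\mathfrak{su}(2^n)$ is the real Lie algebra (bracket $[A,B]=AB-BA$) generated by $i\sum_jX_j$ and $i\sum_{1\le j<k\le n}Z_jZ_k$. For non-negative integers $p,q,r$ with $p+q+r\le n$, the single symbol $X^pY^qZ^r$ denotes the matrix $i\sum X_RY_SZ_T$, the sum over all mutually disjoint $R,S,T\subseteq[n]$ with $|R|=p,|S|=q,|T|=r$, where $X_R=\prod_{j\in R}X_j$, etc. Factors with exponent $0$ are omitted; in particular $X^1=i\sum_jX_j$ and $Z^2=i\sum_{j<k}Z_jZ_k$. *)

(* Defs.v *)
(* [R : realType] is the field of real numbers and [R[i]] the
   field of complex numbers over it. *)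
From HB Require Import structures.
From mathcomp Require Import all_boot all_order all_algebra.
From mathcomp Require Import mathcomp_extra boolp classical_sets reals.
From mathcomp Require Import complex mxtens.

Set Implicit Arguments.
Unset Strict Implicit.
Unset Printing Implicit Defensive.

Import GRing.Theory.
Local Open Scope ring_scope.
Local Open Scope complex_scope.

(* Complex matrices as a finite-dimensional REAL vector space.  The alias is
   needed because 'M[R[i]]_N itself is canonically a vector space over R[i]. *)
Definition realmx (R : realType) (N : nat) : Type := 'M[R[i]]_N.

HB.instance Definition _ (R : realType) (N : nat) :=
  GRing.Zmodule.on (realmx R N).

Section RealMatrixSpace.
Variables (R : realType) (N : nat).

Definition realmx_scale (a : R) (A : realmx R N) : realmx R N :=
  a%:C *: (A : 'M[R[i]]_N).

Fact realmx_scaleA a b A :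
  realmx_scale a (realmx_scale b A) = realmx_scale (a * b) A.
Proof. by rewrite /realmx_scale scalerA rmorphM. Qed.

Fact realmx_scale1 : left_id 1 realmx_scale.
Proof. by move=> A; rewrite /realmx_scale rmorph1 scale1r. Qed.

Fact realmx_scaleDr : right_distributive realmx_scale +%R.
Proof. by move=> a A B; rewrite /realmx_scale scalerDr. Qed.

Fact realmx_scaleDl A : {morph realmx_scale^~ A : a b / a + b}.
Proof. by move=> a b; rewrite /realmx_scale rmorphD scalerDl. Qed.

HB.instance Definition _ := GRing.Zmodule_isLmodule.Build R (realmx R N)
  realmx_scaleA realmx_scale1 realmx_scaleDr realmx_scaleDl.

Lemma realmx_scaleE (a : R) (A : realmx R N) :
  a *: A = (a%:C *: (A : 'M[R[i]]_N)) :> realmx R N.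
Proof. by []. Qed.

Fact realmx_vect_iso : Vector.axiom (N * N + N * N) (realmx R N).
Proof.
exists (fun A : realmx R N =>
  row_mx (mxvec (map_mx (@complex.Re R) A)) (mxvec (map_mx (@complex.Im R) A))).
  move=> a A B; rewrite scale_row_mx add_row_mx -!linearP; congr row_mx;
    congr mxvec; apply/matrixP => i j; rewrite !mxE;
    case: (A i j) (B i j) => [x y] [z t] /=; by rewrite mul0r ?subr0 ?addr0.
exists (fun v : 'rV[R]_(N * N + N * N) =>
  \matrix_(i, j) (vec_mx (lsubmx v) i j +i* vec_mx (rsubmx v) i j)).
  move=> A; apply/matrixP => i j; rewrite mxE row_mxKl row_mxKr !mxvecK !mxE.
  by case: (A i j).
move=> v; rewrite -[RHS]hsubmxK; congr row_mx; rewrite -[RHS]vec_mxK;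
  by congr mxvec; apply/matrixP => i j; rewrite !mxE.
Qed.

HB.instance Definition _ :=
  Lmodule_hasFinDim.Build R (realmx R N) realmx_vect_iso.

End RealMatrixSpace.

Section LieClosure.
Variables (R : realType) (N : nat).
Implicit Types (U V : {vspace realmx R N}) (A B : realmx R N).

Definition lie A B : realmx R N := A *m B - B *m A.

Definition lie_stable U := forall A B, A \in U -> B \in U -> lie A B \in U.

Definition lie_step U : {vspace realmx R N} :=
  (U + <<[seq lie A B | A <- vbasis U, B <- vbasis U]>>)%VS.

(* The real Lie algebra generated by X: adjoining brackets must become
   stationary after at most \dim {:realmx R N} steps.  See [lie_closureP]. *)
Definition lie_closure (X : seq (realmx R N)) : {vspace realmx R N} :=
  iter (\dim {:realmx R N}) lie_step <<X>>%VS.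

Definition lier B A := lie A B.

Fact lie_linearl B : linear (lier B).
Proof.
move=> a A1 A2; rewrite /lier /lie realmx_scaleE.
rewrite mulmxDl mulmxDr -scalemxAl -scalemxAr realmx_scaleE scalerBr.
by rewrite opprD addrACA.
Qed.

Fact lie_linearr A : linear (lie A).
Proof.
move=> a B1 B2; rewrite /lie realmx_scaleE.
rewrite mulmxDl mulmxDr -scalemxAl -scalemxAr realmx_scaleE scalerBr.
by rewrite opprD addrACA.
Qed.

HB.instance Definition _ B :=
  GRing.isLinear.Build R (realmx R N) (realmx R N) _ (lier B) (lie_linearl B).
HB.instance Definition _ A :=
  GRing.isLinear.Build R (realmx R N) (realmx R N) _ (lie A) (lie_linearr A).

Lemma lie_spanP U V :
  (<<[seq lie A B | A <- vbasis U, B <- vbasis U]>> <= V)%VS <->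
  (forall A B, A \in U -> B \in U -> lie A B \in V).
Proof.
split=> [sUV A B UA UB | sUV]; last first.
  apply/span_subvP => _ /allpairsP[[A B] /= [/vbasis_mem UA /vbasis_mem UB ->]].
  exact: sUV.
rewrite (coord_vbasis UA) (coord_vbasis UB).
rewrite -[lie _ _]/(lier _ _) linear_sum; apply: memv_suml => i _.
rewrite linearZ memvZ //= /lier linear_sum; apply: memv_suml => j _.
rewrite linearZ memvZ //=; apply: (subvP sUV); apply: memv_span.
by apply: allpairs_f; apply/mem_nth; rewrite size_tuple.
Qed.

Lemma lie_closureP X :
  [/\ {subset X <= lie_closure X}, lie_stable (lie_closure X) &
      forall U, {subset X <= U} -> lie_stable U -> (lie_closure X <= U)%VS].
Proof.
pose W k := iter k lie_step <<X>>%VS.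
have W_S k : (W k <= W k.+1)%VS by rewrite /W iterS addvSl.
have W_le k : (<<X>> <= W k)%VS.
  by elim: k => [|k IHk]; [apply: subvv | apply: subv_trans IHk (W_S k)].
have fixP k : (W k.+1 <= W k)%VS \/ (k < \dim (W k.+1))%N.
  elim: k => [|k [fix_k | lt_k]].
  - case: (boolP (W 1%N <= W 0%N)%VS) => [|nle]; [by left | right].
    rewrite lt0n; apply: contra nle; rewrite dimv_eq0 => /eqP->; exact: sub0v.
  - left; have eqW : W k.+1 = W k by apply/eqP; rewrite eqEsubv fix_k W_S.
    by rewrite {1}/W iterS -/(W k.+1) {1}eqW -[lie_step _]/(W k.+1) subvv.
  - case: (boolP (W k.+2 <= W k.+1)%VS) => [|nle]; [by left | right].
    apply: leq_ltn_trans lt_k _.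
    rewrite ltnNge; apply: contra nle => le_dim.
    by rewrite -(eqP (_ : W k.+1 == W k.+2)) ?subvv // eqEdim W_S.
have stab : (lie_step (lie_closure X) <= lie_closure X)%VS.
  case: (fixP (\dim {:realmx R N})) => // /leq_trans/(_ (dimvS (subvf _))).
  by rewrite ltnn.
split.
- by move=> A XA; apply: (subvP (W_le _)); apply: memv_span.
- by apply/lie_spanP; apply: subv_trans stab; apply: addvSr.
move=> U sXU stabU; rewrite /lie_closure; elim: (\dim _) => [|k IHk] /=.
  exact/span_subvP.
rewrite subv_add IHk; apply/lie_spanP => A B WA WB.
by apply: stabU; apply: (subvP IHk).
Qed.

End LieClosure.

Section Pauli.
Variable R : realType.

Definition pauliX : 'M[R[i]]_2 := block_mx 0 1%:M
                                           1%:M 0 :> 'M_(1 + 1).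
Definition pauliY : 'M[R[i]]_2 := block_mx 0 (- 'i%C)%:M
                                           'i%C%:M 0 :> 'M_(1 + 1).
Definition pauliZ : 'M[R[i]]_2 := block_mx 1%:M 0
                                           0 (-1)%:M :> 'M_(1 + 1).

Variable n : nat.

Fact qubit_dim (j : 'I_n) : (2 ^ j * 2 * 2 ^ (n - j.+1) = 2 ^ n)%N.
Proof. by rewrite -expnSr -expnD subnKC. Qed.

(* I (x) ... (x) I (x) P (x) I (x) ... (x) I with P in tensor position j; the
   qubits are numbered from 0. *)
Definition on_qubit (P : 'M[R[i]]_2) (j : 'I_n) : 'M[R[i]]_(2 ^ n) :=
  castmx (qubit_dim j, qubit_dim j)
    ((1%:M : 'M_(2 ^ j)) *t P *t (1%:M : 'M_(2 ^ (n - j.+1)))).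

Definition on_set (P : 'M[R[i]]_2) (A : {set 'I_n}) : 'M[R[i]]_(2 ^ n) :=
  \prod_(j in A) on_qubit P j.

(* The matrix denoted by the single symbol X^p Y^q Z^r; it is a sum over set
   configurations, not a product of powers. *)
Definition XYZ (p q r : nat) : realmx R (2 ^ n) :=
  'i%C *: \sum_(A : {set 'I_n} | #|A| == p)
        \sum_(B : {set 'I_n} | (#|B| == q) && [disjoint A & B])
        \sum_(D : {set 'I_n} |
                [&& #|D| == r, [disjoint A & D] & [disjoint B & D]])
          (on_set pauliX A * on_set pauliY B * on_set pauliZ D).

Definition mixer : realmx R (2 ^ n) :=
  'i%C *: \sum_(j < n) on_qubit pauliX j.

Definition phase_separator : realmx R (2 ^ n) :=
  'i%C *: \sum_(j < n) \sum_(k < n | (j < k)%N)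
          (on_qubit pauliZ j * on_qubit pauliZ k).

(* The dynamical Lie algebra of QAOA-MaxCut on the complete graph K_n. *)
Definition dla_complete : {vspace realmx R (2 ^ n)} :=
  lie_closure [:: mixer; phase_separator].

Local Open Scope classical_set_scope.

Definition XYZ_family (P : nat -> nat -> nat -> bool) :
    set (realmx R (2 ^ n)) :=
  [set v | exists p q r : nat, [/\ (p + q + r <= n)%N, P p q r & v = XYZ p q r]].

Definition J1 := XYZ_family (fun p q r => [&& ~~ odd p, odd q & odd r])
                   `\ XYZ 0 1 1.
Definition J2 := XYZ_family (fun p q r => [&& odd p, q == 1%N & odd r]).
Definition J3 := XYZ_family (fun p q r => [&& odd p, odd q, odd r & 3 <= q])%N.
Definition J4 := XYZ_family (fun p q r => [&& odd p, ~~ odd q & ~~ odd r]).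
Definition J5 := [set XYZ 0 0 2; XYZ 0 2 0; XYZ 0 1 1].
Definition L1 := [set lie (XYZ 1 0 0) v | v in J1].
Definition L2 := [set lie (XYZ 0 0 2) v | v in J2].

End Pauli.

Arguments J1 : clear implicits.
Arguments J2 : clear implicits.
Arguments J3 : clear implicits.
Arguments J4 : clear implicits.
Arguments J5 : clear implicits.
Arguments L1 : clear implicits.
Arguments L2 : clear implicits.

(* [basis_of U s] forces s to be free, hence duplicate-free, so that B is a
   basis of U as a set of vectors. *)
Definition basis_set (K : fieldType) (V : vectType K) (U : {vspace V})
    (B : set V) : Prop :=
  exists2 s : seq V, B = [set` s]%classic & basis_of U s.

(* Main.v *)
Require Import Defs.
From HB Require Import structures.
From mathcomp Require Import all_boot all_order all_algebra.
From mathcomp Require Import classical_sets reals.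
From mathcomp Require Import complex mxtens zify ring.

(* Write (p,q,r) for the symbol X^p Y^q Z^r.  On these symbols, ad X^1 moves
   (p,q,r) to (p,q+1,r-1) and (p,q-1,r+1), and ad Z^2 moves it to
   (p+1,q-1,r+1), (p+1,q-1,r-1), (p-1,q+1,r+1), (p-1,q+1,r-1), with explicit
   coefficients; this follows from one-qubit computations because Z^2 is, up to
   constants, half the square of the sum of the Z_j, so that its commutator is
   the anticommutator of that sum with the commutator of that sum.

   R lies in g: the square of ad X^1 connects all (p,q,r) with fixed p and q+r
   and fixed parities, and ad Z^2 then produces the symbols of parities (e,o,o)
   and (o,e,e) by induction on p; the symbols (o,o,o) are rotations of (o,e,e).

   R spans g: it suffices that span R is stable under ad X^1 and ad Z^2.  Only
   [Z^2, (p,q,r)] with p, q, r odd and q >= 3 is not immediate.  Modulo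
   ad X^1 (e,o,o), the symbol (p,2a,2b) is binomial(a+b,a) times (p,0,2(a+b)),
   and this makes [Z^2, (p,2a+1,2b+1)] congruent to binomial(a+b,a) times
   [Z^2, (p,1,2(a+b)+1)].

   R is free: there is a family of linear forms in which R is triangular.  The
   forms are coordinates, except on L_2, where the rotation-invariant forms
   sum_j binomial(s,j) (coordinate at (p,2j,2(s-j))), which vanish on L_1, are
   used. *)

Set Implicit Arguments.
Unset Strict Implicit.
Unset Printing Implicit Defensive.

Import GRing.Theory Num.Theory.
Local Open Scope ring_scope.

(** * Operators acting on one qubit *)

Section Tensor.
Variable C : comPzRingType.

Lemma tensmxA_unit (m n p : nat) (A : 'M[C]_m) (B : 'M[C]_n) (D : 'M[C]_p) :
  A *t B *t D = castmx (mulnA m n p, mulnA m n p) (A *t (B *t D)).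
Proof.
apply/matrixP => i j; rewrite castmxE !mxE mulrA.
(* Both nestings decode an index into the same three mixed-radix digits. *)
have idx (k : nat) : [/\ k %/ p %/ n = k %/ (n * p),
    k %/ p %% n = k %% (n * p) %/ p & k %% p = k %% (n * p) %% p]%N.
  split; first by rewrite mulnC divnMA.
    by rewrite modn_divl.
  by rewrite modn_dvdm // dvdn_mull.
have [i1 i2 i3] := idx i.
have [j1 j2 j3] := idx j.
by congr (A _ _ * B _ _ * D _ _); apply: val_inj.
Qed.

Lemma scalar_tensmx (m n : nat) : 1%:M *t 1%:M = 1%:M :> 'M[C]_(m * n).
Proof.
apply/matrixP => i j; rewrite !mxE -natrM mulnb; congr ((_ : bool)%:R).
by rewrite -(inj_eq (can_inj (@mxtens_unindexK m n))).
Qed.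

(** The sizes of the identity blocks are equal only up to a proof; once they are identified, both
    products are [A *t B] by the mixed product rule. *)
Lemma castmx_tens_comm (m p p' N : nat) (e : (m * p)%N = N) (e' : (m * p')%N = N)
    (A : 'M[C]_m) (B : 'M[C]_p') : p = p' ->
  castmx (e, e) (A *t (1%:M : 'M_p)) *m castmx (e', e') ((1%:M : 'M_m) *t B)
  = castmx (e', e') ((1%:M : 'M_m) *t B) *m castmx (e, e) (A *t (1%:M : 'M_p)).
Proof.
move=> pp'; subst p'; subst N; rewrite (eq_irrelevance e' (erefl _)) !castmx_id.
by rewrite !tensmx_mul !mul1mx !mulmx1.
Qed.

(** Splitting the leading identity in two shows an operator on a late qubit as the identity on an
    initial block of qubits. *)
Lemma castmx_tens_split (K m u a w N : nat) (Q : 'M[C]_a)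
    (e : (K * a * w)%N = N) (e' : (m * (u * (a * w)))%N = N) : K = (m * u)%N ->
  castmx (e, e) ((1%:M : 'M_K) *t Q *t (1%:M : 'M_w))
  = castmx (e', e') ((1%:M : 'M_m) *t ((1%:M : 'M_u) *t (Q *t (1%:M : 'M_w)))).
Proof.
move=> defK; subst K; rewrite -scalar_tensmx (tensmxA_unit (_ *t _)).
rewrite (tensmxA_unit _ _ (_ *t _)) !castmx_comp.
by rewrite (eq_irrelevance (etrans _ _) e').
Qed.
End Tensor.

Section OnQubit.
Variables (R : realType) (n : nat).
Implicit Types (P Q : 'M[R[i]]_2) (j k : 'I_n).
Local Notation oq := (@on_qubit R n).

Lemma on_qubitM P Q j : oq P j * oq Q j = oq (P *m Q) j.
Proof.
rewrite /on_qubit -[LHS]/(_ *m _).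
move: (qubit_dim j); set N := (2 ^ n)%N; case: N / => //.
by rewrite !castmx_id !tensmx_mul !mulmx1.
Qed.

Lemma on_qubit1 j : oq 1%:M j = 1.
Proof.
rewrite /on_qubit !scalar_tensmx; move: (qubit_dim j).
by set N := (2 ^ n)%N; case: N /; rewrite castmx_id.
Qed.

Lemma on_qubitZ (a : R[i]) P j : oq (a *: P) j = a *: oq P j.
Proof.
rewrite /on_qubit; move: (qubit_dim j).
by set N := (2 ^ n)%N; case: N /; apply/matrixP => x y; rewrite !castmx_id !mxE; ring.
Qed.

Lemma on_qubitD P Q j : oq (P + Q) j = oq P j + oq Q j.
Proof.
rewrite /on_qubit; move: (qubit_dim j).
by set N := (2 ^ n)%N; case: N /; apply/matrixP => x y; rewrite !castmx_id !mxE; ring.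
Qed.

Lemma on_qubitN P j : oq (- P) j = - oq P j.
Proof. by rewrite -scaleN1r on_qubitZ scaleN1r. Qed.

Lemma on_qubit_comm P Q j k : j != k -> oq P j * oq Q k = oq Q k * oq P j.
Proof.
wlog lt_jk : P Q j k / (j < k)%N.
  move=> H neq_jk; have [lt_jk|lt_kj|/val_inj eq_jk] := ltngtP j k.
  - exact: H.
  - by rewrite (H _ _ _ _ lt_kj) // eq_sym.
  - by rewrite eq_jk eqxx in neq_jk.
move=> _; have lt_kn := ltn_ord k; have lt_jn := ltn_ord j.
(* The tensor product is cut just after qubit [j], so that [P] acts on the first block and [Q] on
   the second. *)
have e' : (2 ^ j * 2 * (2 ^ (k - j.+1) * (2 * 2 ^ (n - k.+1))) = 2 ^ n)%N.
  by rewrite -!expnSr -!expnS -!expnD; congr (_ ^ _)%N; lia.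
rewrite [oq Q k](castmx_tens_split _ _ e'); last first.
  by rewrite -!expnSr -!expnD; congr (_ ^ _)%N; lia.
apply: castmx_tens_comm; rewrite -expnS -expnD; congr (_ ^ _)%N; lia.
Qed.
End OnQubit.

(** * Pauli strings *)

(* The two bits are the X and Z components of the letter, so Y is [(true, true)]. *)
Definition letter := (bool * bool)%type.
Notation pI := ((false, false) : letter).
Notation pX := ((true, false) : letter).
Notation pY := ((true, true) : letter).
Notation pZ := ((false, true) : letter).

Section Letters.
Variable R : realType.

Definition pauli (a : letter) : 'M[R[i]]_2 :=
  match a with
  | (false, false) => 1%:M
  | (true, false) => pauliX R
  | (true, true) => pauliY R
  | (false, true) => pauliZ R
  end.

Lemma pauliXY : pauliX R *m pauliY R = 'i%C *: pauliZ R.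
Proof.
rewrite /pauliX /pauliY /pauliZ (@mulmx_block _ 1 1 1 1 1 1).
rewrite (@scale_block_mx _ 1 1 1 1).
rewrite !mul0mx !mulmx0 !mul1mx !add0r !addr0 scaler0 !scale_scalar_mx.
by rewrite mulr1 mulrN1.
Qed.

Lemma pauliXX : pauliX R *m pauliX R = 1%:M.
Proof.
rewrite /pauliX (@mulmx_block _ 1 1 1 1 1 1) !mul0mx !mulmx0 !mul1mx !add0r !addr0.
by rewrite -scalar_mx_block.
Qed.

Lemma pauliZZ : pauliZ R *m pauliZ R = 1%:M.
Proof.
rewrite /pauliZ (@mulmx_block _ 1 1 1 1 1 1) !mul0mx !mulmx0 !mul1mx !add0r !addr0.
by rewrite -scalar_mxM mulrNN mulr1 -scalar_mx_block.
Qed.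

Lemma pauliZX : pauliZ R *m pauliX R = 'i%C *: pauliY R.
Proof.
rewrite /pauliX /pauliY /pauliZ (@mulmx_block _ 1 1 1 1 1 1).
rewrite (@scale_block_mx _ 1 1 1 1).
rewrite !mul0mx !mulmx0 !mul1mx !mulmx1 !add0r !addr0 scaler0 !scale_scalar_mx.
by rewrite mulrN -expr2 sqr_i opprK.
Qed.

Lemma pauliXZ : pauliX R *m pauliZ R = - ('i%C *: pauliY R).
Proof.
rewrite /pauliX /pauliY /pauliZ (@mulmx_block _ 1 1 1 1 1 1).
rewrite (@scale_block_mx _ 1 1 1 1) (@opp_block_mx _ 1 1 1 1).
rewrite !mul0mx !mulmx0 !mul1mx !add0r !addr0 scaler0 oppr0 !scale_scalar_mx.
have oppM (x : R[i]) : - (x%:M) = (- x)%:M :> 'M_1 by rewrite rmorphN.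
by rewrite !oppM mulrN -expr2 sqr_i !opprK.
Qed.

Lemma scaleiK (M : 'M[R[i]]_2) : 'i%C *: ('i%C *: M) = - M.
Proof. by rewrite scalerA -expr2 sqr_i scaleN1r. Qed.

Lemma pauliYE : pauliY R = 'i%C *: (pauliX R *m pauliZ R).
Proof. by rewrite pauliXZ scalerN scaleiK opprK. Qed.

Lemma pauliZY : pauliZ R *m pauliY R = - ('i%C *: pauliX R).
Proof.
rewrite pauliYE -scalemxAr mulmxA pauliZX -scalemxAl scaleiK pauliYE.
by rewrite -scalemxAl -mulmxA pauliZZ mulmx1.
Qed.

Lemma pauliYZ : pauliY R *m pauliZ R = 'i%C *: pauliX R.
Proof. by rewrite pauliYE -scalemxAl -mulmxA pauliZZ mulmx1. Qed.

Lemma pauliYX : pauliY R *m pauliX R = - ('i%C *: pauliZ R).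
Proof.
by rewrite pauliYE -scalemxAl -mulmxA pauliZX -scalemxAr scaleiK pauliXY.
Qed.

Lemma pauliYY : pauliY R *m pauliY R = 1%:M.
Proof.
rewrite {1}pauliYE -scalemxAl -mulmxA pauliZY mulmxN -scalemxAr pauliXX.
by rewrite scalerN scaleiK opprK.
Qed.

Lemma pauli_sqr a : pauli a *m pauli a = 1%:M.
Proof.
by case: a => [[] []] /=; rewrite ?mulmx1 ?pauliXX ?pauliYY ?pauliZZ.
Qed.

Lemma pauliX_sign a : pauliX R *m pauli a = (-1) ^+ a.2 *: (pauli a *m pauliX R).
Proof.
by case: a => [[] []] /=; rewrite ?(expr0, expr1, scale1r, scaleN1r, mulmx1, mul1mx,
  pauliXY, pauliYX, pauliXZ, pauliZX, opprK).
Qed.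

Lemma pauliZ_sign a : pauliZ R *m pauli a = (-1) ^+ a.1 *: (pauli a *m pauliZ R).
Proof.
by case: a => [[] []] /=; rewrite ?(expr0, expr1, scale1r, scaleN1r, mulmx1, mul1mx,
  pauliZY, pauliYZ, pauliXZ, pauliZX, opprK).
Qed.

(** A letter anticommutes with the product as soon as its signs against [a] and [b] differ. Z
    detects a difference of X bits, and X one of Z bits. *)
Lemma pauli_anti a b : a != b -> exists2 c, pauli c *m pauli c = 1%:M &
  pauli c *m (pauli a *m pauli b) = - ((pauli a *m pauli b) *m pauli c).
Proof.
move=> neq_ab; have [eq1|neq1] := eqVneq a.1 b.1; last first.
  exists pZ; first exact: pauli_sqr.
  rewrite mulmxA /= pauliZ_sign -scalemxAl -mulmxA pauliZ_sign -scalemxAr scalerA.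
  rewrite -signr_addb mulmxA -[RHS]scaleN1r; congr (_ *: _).
  by case: (a.1) (b.1) neq1 => [] [].
have neq2 : a.2 != b.2.
  by case: a b neq_ab eq1 => [a1 a2] [b1 b2] /= + e; rewrite xpair_eqE e eqxx.
exists pX; first exact: pauli_sqr.
rewrite mulmxA /= pauliX_sign -scalemxAl -mulmxA pauliX_sign -scalemxAr scalerA.
rewrite -signr_addb mulmxA -[RHS]scaleN1r; congr (_ *: _).
by case: (a.2) (b.2) neq2 => [] [].
Qed.

Lemma pauliX_comm a : pauliX R *m pauli a - pauli a *m pauliX R =
  (2 * 'i%C) *: ((if a == pY then pauli pZ else 0)
                 - (if a == pZ then pauli pY else 0)).
Proof.
case: a => [[] []] /=; rewrite ?mulmx1 ?mul1mx ?subrr ?scaler0 //.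
  by rewrite pauliXY pauliYX opprK subr0 -scalerDl -mulr2n mulr_natl.
by rewrite pauliXZ pauliZX sub0r scalerN -opprD -scalerDl -mulr2n mulr_natl.
Qed.

Lemma pauliZ_comm a : pauliZ R *m pauli a - pauli a *m pauliZ R =
  (2 * 'i%C) *: ((if a == pX then pauli pY else 0)
                 - (if a == pY then pauli pX else 0)).
Proof.
case: a => [[] []] /=; rewrite ?mulmx1 ?mul1mx ?subrr ?scaler0 //.
  by rewrite pauliZY pauliYZ sub0r scalerN -opprD -scalerDl -mulr2n mulr_natl.
by rewrite pauliXZ pauliZX opprK subr0 -scalerDl -mulr2n mulr_natl.
Qed.

Lemma pauliZ_anticomm a : pauliZ R *m pauli a + pauli a *m pauliZ R =
  2 *: ((if a == pI then pauli pZ else 0) + (if a == pZ then pauli pI else 0)).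
Proof.
case: a => [[] []] /=; rewrite ?mulmx1 ?mul1mx ?addr0 ?add0r ?scaler0.
- by rewrite pauliZY pauliYZ addNr.
- by rewrite pauliXZ pauliZX subrr.
- by rewrite pauliZZ scaler_nat mulr2n.
- by rewrite scaler_nat mulr2n.
Qed.

End Letters.

(** Meant for two strings split at one qubit: [a] and [b] are the letters there, [s] and [t] the
    remaining factors, which commute with any operator at that qubit. *)
Lemma anticomm_lift (S : pzRingType) (a b c s t : S) :
  b * s = s * b -> c * s = s * c -> c * t = t * c ->
  c * (a * b) = - (a * b * c) ->
  c * (a * s * (b * t)) = - (a * s * (b * t) * c).
Proof.
move=> bs cs ct cab.
have -> : a * s * (b * t) = a * b * (s * t) by rewrite -!mulrA (mulrA s) -bs !mulrA.
by rewrite mulrA cab mulNr -!mulrA (mulrA c s) cs -(mulrA s) ct.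
Qed.

Section Strings.
Variables (R : realType) (n : nat).
Local Notation word := {ffun 'I_n -> letter}.
Local Notation oq := (@on_qubit R n).
Implicit Types (f g : word) (j k : 'I_n) (a b c : letter).

Definition string f : 'M[R[i]]_(2 ^ n) := \prod_j oq (pauli R (f j)) j.

Definition set_letter f j a : word := [ffun k => if k == j then a else f k].

Definition string_off f j := \prod_(k | k != j) oq (pauli R (f k)) k.

(** Factors at different qubits commute, so the product splits into one masked to [j] and one masked
    to the other qubits. *)
Lemma stringD1 f j : string f = oq (pauli R (f j)) j * string_off f j.
Proof.
rewrite /string_off big_mkcond /=.
have -> : oq (pauli R (f j)) j =
    \prod_k (if k == j then oq (pauli R (f k)) k else 1).
  by rewrite -big_mkcond big_pred1_eq.
rewrite -prodrM_comm => [|i k _ _].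
  by apply: eq_bigr => k _; case: eqVneq => _; rewrite ?mulr1 ?mul1r.
rewrite /GRing.comm; case: eqVneq => [->|_]; last by rewrite mul1r mulr1.
case: (eqVneq k j) => [->|neq_kj] /=; first by rewrite mul1r mulr1.
by rewrite on_qubit_comm // eq_sym.
Qed.

Lemma string_off_comm P f j : oq P j * string_off f j = string_off f j * oq P j.
Proof. by apply: commr_prod => k neq_kj; apply: on_qubit_comm; rewrite eq_sym. Qed.

Lemma string_off_set_letter f j a : string_off (set_letter f j a) j = string_off f j.
Proof.
by apply: eq_bigr => k neq_kj; rewrite ffunE (negPf neq_kj).
Qed.

Lemma string_set_letter f j a :
  string (set_letter f j a) = oq (pauli R a) j * string_off f j.
Proof. by rewrite (stringD1 _ j) string_off_set_letter ffunE eqxx. Qed.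

Lemma mul_string P f j : oq P j * string f = oq (P *m pauli R (f j)) j * string_off f j.
Proof. by rewrite (stringD1 f j) mulrA on_qubitM. Qed.

Lemma string_mul P f j : string f * oq P j = oq (pauli R (f j) *m P) j * string_off f j.
Proof. by rewrite (stringD1 f j) -mulrA -string_off_comm mulrA on_qubitM. Qed.

(** Commuting or anticommuting with a Pauli matrix at one qubit replaces the letter there; these
    replacements are the terms of all the expansions below. *)
Definition hop (a b : letter) f j : 'M[R[i]]_(2 ^ n) :=
  if f j == a then string (set_letter f j b) else 0.

Lemma hopE a b f j :
  hop a b f j = oq (if f j == a then pauli R b else 0) j * string_off f j.
Proof.
rewrite /hop string_set_letter; case: ifP => // _.
by rewrite -(subrr (pauli R b)) on_qubitD on_qubitN subrr mul0r.
Qed.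

Lemma comm_X_string f j :
  oq (pauliX R) j * string f - string f * oq (pauliX R) j
  = (2 * 'i%C) *: (hop pY pZ f j - hop pZ pY f j).
Proof.
rewrite mul_string string_mul !hopE -2!mulrBl -2!on_qubitN -2!on_qubitD.
by rewrite pauliX_comm on_qubitZ -[_ * _]scalemxAl.
Qed.

Lemma comm_Z_string f j :
  oq (pauliZ R) j * string f - string f * oq (pauliZ R) j
  = (2 * 'i%C) *: (hop pX pY f j - hop pY pX f j).
Proof.
rewrite mul_string string_mul !hopE -2!mulrBl -2!on_qubitN -2!on_qubitD.
by rewrite pauliZ_comm on_qubitZ -[_ * _]scalemxAl.
Qed.

Lemma anticomm_Z_string f j :
  oq (pauliZ R) j * string f + string f * oq (pauliZ R) j
  = 2 *: (hop pI pZ f j + hop pZ pI f j).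
Proof.
rewrite mul_string string_mul 2!hopE -2!mulrDl -2!on_qubitD.
by rewrite pauliZ_anticomm on_qubitZ -[_ * _]scalemxAl.
Qed.

Lemma string_sqr f : string f * string f = 1.
Proof.
rewrite -prodrM_comm => [|j k _ _].
  by apply: big1 => j _; rewrite on_qubitM pauli_sqr on_qubit1.
by rewrite /GRing.comm; have [->//|neq_jk] := eqVneq j k; apply: on_qubit_comm.
Qed.

(* Distinct strings differ at some qubit, where a Pauli matrix anticommutes with
   the product of their letters; hence that product has trace zero. *)
Lemma tr_string f g : \tr (string f *m string g) = (if f == g then (2 ^ n)%:R else 0).
Proof.
have [->|neq_fg] := eqVneq f g.
  by rewrite -[_ *m _]/(_ * _) string_sqr mxtrace1.
have [j neq_j] : exists j, f j != g j.
  apply/existsP; rewrite -[X in is_true X]negbK negb_exists; apply: contra neq_fg.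
  by move=> /forallP eq_fg; apply/eqP/ffunP => j; apply/eqP; rewrite -[_ == _]negbK.
have [c cc cfg] := pauli_anti R neq_j.
set M := _ *m _; pose L : 'M[R[i]]_(2 ^ n) := oq (pauli R c) j.
have LM : L *m M = - (M *m L).
  rewrite /M (stringD1 f j) (stringD1 g j).
  apply: (anticomm_lift (string_off_comm _ _ _) (string_off_comm _ _ _)
    (string_off_comm _ _ _)).
  by rewrite !on_qubitM cfg on_qubitN.
have : \tr M = - \tr M.
  have LL : L *m L = 1%:M by rewrite -[_ *m _]/(_ * _) on_qubitM cc on_qubit1.
  rewrite -{1}[M]mul1mx -LL -mulmxA LM mulmxN linearN /=; congr (- _).
  by rewrite mxtrace_mulC -mulmxA LL mulmx1.
move=> /eqP; rewrite -subr_eq0 opprK -mulr2n -mulr_natr mulf_eq0 pnatr_eq0 orbF.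
by move/eqP.
Qed.
End Strings.

(** * Sums of Pauli strings of a given type *)

Section Types.
Variables (R : realType) (n : nat).
Local Notation word := {ffun 'I_n -> letter}.
Local Notation oq := (@on_qubit R n).
Local Notation string := (@string R n).
Local Notation mx := 'M[R[i]]_(2 ^ n).
Implicit Types (f g : word) (j k : 'I_n) (a b c : letter) (t : letter -> nat).

Definition letter_count c f := #|[pred k | f k == c]|.

(** The additive form avoids truncated subtraction. *)
Lemma letter_count_set c f j b :
  (letter_count c (set_letter f j b) + (f j == c) = letter_count c f + (b == c))%N.
Proof.
rewrite /letter_count (cardD1 j) [in RHS](cardD1 j) !inE ffunE eqxx.
rewrite (_ : #|_| = #|[predD1 [pred k | f k == c] & j]|).
  by case: (b == c); case: (f j == c); rewrite ?addn0 ?add0n ?addn1 ?add1n.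
by apply: eq_card => k; rewrite !inE ffunE; case: eqVneq.
Qed.

Lemma sum_letter (V : nmodType) (F : letter -> V) :
  \sum_c F c = F pI + (F pX + (F pY + F pZ)).
Proof.
rewrite (bigD1 pI) // (bigD1 pX) // (bigD1 pY) // (bigD1 pZ) //=.
by rewrite big1 ?addr0 // => [[[] []]].
Qed.

Lemma sum_letter_count f :
  (letter_count pI f + (letter_count pX f + (letter_count pY f + letter_count pZ f))
   = n)%N.
Proof.
transitivity (\sum_c letter_count c f)%N.
  exact/esym/(sum_letter (fun c => letter_count c f)).
rewrite -[RHS]card_ord -sum1_card (partition_big f predT) //=.
by apply: eq_bigr => c _; rewrite /letter_count -sum1_card.
Qed.

Definition has_type t f := [forall c, letter_count c f == t c].

Definition type_sum t : mx := \sum_(f | has_type t f) string f.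

Lemma eq_type_sum t1 t2 : t1 =1 t2 -> type_sum t1 = type_sum t2.
Proof.
by move=> eq_t; apply: eq_bigl => f; apply: eq_forallb => c; rewrite eq_t.
Qed.

Lemma type_sum0 t : (t pI + (t pX + (t pY + t pZ)) != n)%N -> type_sum t = 0.
Proof.
move=> neq_n; apply: big1 => f /forallP tf; case/negP: neq_n.
by rewrite -!(eqP (tf _)) sum_letter_count.
Qed.

Definition shift_type a b t : letter -> nat :=
  fun c => if c == a then (t a).-1 else if c == b then (t b).+1 else t c.

Lemma has_type_set_letter a b t g j : a != b -> g j = b ->
  has_type t (set_letter g j a) = (0 < t a)%N && has_type (shift_type a b t) g.
Proof.
move=> neq_ab gj; have cu c := letter_count_set c g j a; rewrite gj in cu.
apply/forallP/andP => [H | [ta /forallP H]].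
  have {}H c := eqP (H c); split.
    by rewrite -H; have := cu a; rewrite eqxx (eq_sym b) (negPf neq_ab); lia.
  apply/forallP => c; rewrite /shift_type; have := cu c; rewrite !H.
  rewrite !(eq_sym _ c); have [->|_] := eqVneq c a.
    by rewrite (negPf neq_ab) => ?; lia.
  by have [->|_] := eqVneq c b => ?; lia.
move=> c; have := cu c; rewrite (eqP (H c)) /shift_type.
rewrite !(eq_sym _ c); have [->|_] := eqVneq c a.
  by rewrite (negPf neq_ab) => ?; lia.
by have [->|_] := eqVneq c b => ?; lia.
Qed.

(** Double counting: replacing [a] by [b] at [j] matches pairs (f, j) with [f j = a] to pairs (g, j)
    with [g j = b]. Each [g] of the shifted type occurs once for each of its [(t b).+1] letters
    [b]. *)
Lemma sum_hop a b t : a != b ->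
  \sum_(f | has_type t f) \sum_j hop R a b f j
  = type_sum (shift_type a b t) *+ ((0 < t a) * (t b).+1).
Proof.
move=> neq_ab; rewrite exchange_big /=.
transitivity (\sum_j \sum_(g | (0 < t a)%N && has_type (shift_type a b t) g)
   (if g j == b then string g else 0)).
  apply: eq_bigr => j _; rewrite /hop -!big_mkcondr /=.
  rewrite (reindex_onto (fun g => set_letter g j a) (fun f => set_letter f j b)) /=.
    apply: eq_big => [g | g /andP[_ /eqP->] //].
    rewrite ffunE eqxx eqxx andbT.
    have [gj|neq] := eqVneq (g j) b.
      rewrite (has_type_set_letter _ neq_ab) // andbT.
      rewrite [X in _ && X](_ : _ = true) ?andbT //.
      by apply/eqP/ffunP => k; rewrite !ffunE; case: eqVneq => // ->.
    rewrite andbF; apply/negbTE; rewrite negb_and; apply/orP; right.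
    by apply: contra neq => /eqP/ffunP/(_ j); rewrite !ffunE eqxx => ->.
  move=> f /andP[_ /eqP fj].
  by apply/ffunP => k; rewrite !ffunE; case: eqVneq => // ->.
rewrite exchange_big /=; case: (0 < t a)%N => /=; last by rewrite big_pred0.
rewrite mul1n /type_sum -sumrMnl; apply: eq_bigr => g /forallP/(_ b)/eqP.
rewrite {1}/shift_type eqxx eq_sym (negPf neq_ab) => <-.
by rewrite -big_mkcond /= sumr_const.
Qed.

(** With truncated subtraction the four counts add up to n exactly when p + q + r <= n. Above that
    degree no word has this type, and [mono] vanishes. *)
Definition ptype p q r c : nat :=
  match c with
  | (true, false) => p
  | (true, true) => q
  | (false, true) => r
  | (false, false) => n - (p + q + r)
  end.

Definition mono p q r : mx := type_sum (ptype p q r).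

Lemma mono0 p q r : (n < p + q + r)%N -> mono p q r = 0.
Proof. by move=> lt_n; apply: type_sum0 => /=; lia. Qed.

(** * Commutators with the sums of the X_j and of the Z_j *)

Definition sumX : mx := \sum_j oq (pauliX R) j.
Definition sumZ : mx := \sum_j oq (pauliZ R) j.

Lemma type_sum_shift a b p q r p' q' r' m :
  ((0 < ptype p q r a)%N -> shift_type a b (ptype p q r) =1 ptype p' q' r') ->
  type_sum (shift_type a b (ptype p q r)) *+ ((0 < ptype p q r a) * m)
  = mono p' q' r' *+ ((0 < ptype p q r a) * m).
Proof. by case: (0 < _)%N => // H; rewrite (eq_type_sum (H isT)). Qed.

Lemma comm_sumX p q r : (p + q + r <= n)%N ->
  sumX * mono p q r - mono p q r * sumX =
  (2 * 'i%C) *: (mono p q.-1 r.+1 *+ ((0 < q) * r.+1)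
                 - mono p q.+1 r.-1 *+ ((0 < r) * q.+1)).
Proof.
move=> le_n.
transitivity (\sum_(f | has_type (ptype p q r) f)
   (2 * 'i%C) *: (\sum_j hop R pY pZ f j - \sum_j hop R pZ pY f j)).
  rewrite mulr_sumr mulr_suml -[LHS]sumrB; apply: eq_bigr => f _.
  rewrite mulr_sumr mulr_suml -[LHS]sumrB -[in RHS]sumrB scaler_sumr.
  apply: eq_bigr => j _; exact: comm_X_string.
rewrite -scaler_sumr; congr (_ *: _); rewrite [LHS]sumrB; congr (_ - _).
  rewrite sum_hop // (@type_sum_shift _ _ _ _ _ p q.-1 r.+1) //= => q_gt0.
  by case=> [[] []] //; rewrite /shift_type /=; lia.
rewrite sum_hop // (@type_sum_shift _ _ _ _ _ p q.+1 r.-1) //= => r_gt0.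
by case=> [[] []] //; rewrite /shift_type /=; lia.
Qed.

Lemma comm_sumZ p q r : (p + q + r <= n)%N ->
  sumZ * mono p q r - mono p q r * sumZ =
  (2 * 'i%C) *: (mono p.-1 q.+1 r *+ ((0 < p) * q.+1)
                 - mono p.+1 q.-1 r *+ ((0 < q) * p.+1)).
Proof.
move=> le_n.
transitivity (\sum_(f | has_type (ptype p q r) f)
   (2 * 'i%C) *: (\sum_j hop R pX pY f j - \sum_j hop R pY pX f j)).
  rewrite mulr_sumr mulr_suml -[LHS]sumrB; apply: eq_bigr => f _.
  rewrite mulr_sumr mulr_suml -[LHS]sumrB -[in RHS]sumrB scaler_sumr.
  apply: eq_bigr => j _; exact: comm_Z_string.
rewrite -scaler_sumr; congr (_ *: _); rewrite [LHS]sumrB; congr (_ - _).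
  rewrite sum_hop // (@type_sum_shift _ _ _ _ _ p.-1 q.+1 r) //= => q_gt0.
  by case=> [[] []] //; rewrite /shift_type /=; lia.
rewrite sum_hop // (@type_sum_shift _ _ _ _ _ p.+1 q.-1 r) //= => r_gt0.
by case=> [[] []] //; rewrite /shift_type /=; lia.
Qed.

Lemma anticomm_sumZ p q r : (p + q + r <= n)%N ->
  sumZ * mono p q r + mono p q r * sumZ =
  2 *: (mono p q r.+1 *+ r.+1
        + mono p q r.-1 *+ ((0 < r) * (n.+1 - (p + q + r)))).
Proof.
move=> le_n.
transitivity (\sum_(f | has_type (ptype p q r) f)
   2 *: (\sum_j hop R pI pZ f j + \sum_j hop R pZ pI f j)).
  rewrite mulr_sumr mulr_suml -[LHS]big_split; apply: eq_bigr => f _.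
  rewrite mulr_sumr mulr_suml -[LHS]big_split -[in RHS]big_split scaler_sumr.
  apply: eq_bigr => j _; exact: anticomm_Z_string.
rewrite -scaler_sumr; congr (_ *: _); rewrite [LHS]big_split; congr (_ + _).
  rewrite sum_hop // (@type_sum_shift _ _ _ _ _ p q r.+1) /= => [|lt_n].
    have [eq_n|lt_n] := eqVneq (p + q + r)%N n; last first.
      by rewrite (_ : 0 < _)%N ?mul1n //; lia.
    by rewrite mono0 ?mul0rn //; lia.
  by case=> [[] []] //; rewrite /shift_type /=; lia.
rewrite sum_hop // (@type_sum_shift _ _ _ _ _ p q r.-1) /= ?subSn // => r_gt0.
by case=> [[] []] //; rewrite /shift_type /=; lia.
Qed.

Lemma has_type000 f : has_type (ptype 0 0 0) f = (f == [ffun=> pI]).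
Proof.
apply/forallP/eqP => [tf | -> c]; last first.
  rewrite /letter_count; have [->|neq] := eqVneq c pI.
    by rewrite (eq_card (B := predT)) ?card_ord /= ?subn0 // => k; rewrite !inE ffunE.
  rewrite (eq_card0 (A := _)) => [|k]; last by rewrite !inE ffunE eq_sym (negPf neq).
  by case: c neq => [[] []].
apply/ffunP => k; rewrite ffunE.
have : letter_count (f k) f != 0%N.
  by rewrite /letter_count -lt0n; apply/card_gt0P; exists k; rewrite inE.
by rewrite (eqP (tf _)); case: (f k) => [[] []].
Qed.

Lemma mono000 : mono 0 0 0 = 1.
Proof.
rewrite /mono /type_sum (eq_bigl _ _ has_type000) big_pred1_eq; apply: big1 => j _.
by rewrite ffunE on_qubit1.
Qed.

(** The symbol is read off from the anticommutator of [sumZ] with the identity [mono 0 0 0]. *)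
Lemma mono001 : mono 0 0 1 = sumZ.
Proof.
have nz : 2 != 0 :> R[i] by rewrite pnatr_eq0.
apply: (scalerI nz); have := anticomm_sumZ (leq0n n : (0 + 0 + 0 <= n)%N).
rewrite mono000 mulr1 mul1r mul0n mulr0n addr0 mulr1n => <-.
by rewrite scaler_nat mulr2n.
Qed.

Lemma string_single j a :
  string (set_letter [ffun=> pI] j a) = oq (pauli R a) j.
Proof.
rewrite string_set_letter /string_off big1 ?mulr1 // => k _.
by rewrite ffunE on_qubit1.
Qed.

Lemma mono100 : (0 < n)%N -> mono 1 0 0 = sumX.
Proof.
move=> n_gt0; have := sum_hop (a := pI) (b := pX) (ptype 0 0 0) isT.
rewrite (eq_bigl _ _ has_type000) big_pred1_eq /= subn0 n_gt0 mulr1n.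
rewrite (_ : type_sum _ = mono 1 0 0) => [<-|].
  by apply: eq_bigr => j _; rewrite /hop ffunE string_single.
by apply: eq_type_sum => [[[] []]] //=; rewrite /shift_type /=; lia.
Qed.

Lemma sumZ_sqr : (0 < n)%N -> sumZ * sumZ = mono 0 0 2 *+ 2 + n%:R.
Proof.
move=> n_gt0; have nz : 2 != 0 :> R[i] by rewrite pnatr_eq0.
apply: (scalerI nz); have := @anticomm_sumZ 0 0 1 n_gt0.
rewrite mono000 mono001 mul1n subSS subn0 => <-.
by rewrite scaler_nat mulr2n.
Qed.

(** The commutator of z^2 with x is z[z,x] + [z,x]z, and the constant [k%:R] is central. *)
Lemma comm_half_sqr (S : pzRingType) (z m x d : S) (k : nat) :
  z * z = m *+ 2 + k%:R -> z * x - x * z = d ->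
  (m * x - x * m) *+ 2 = z * d + d * z.
Proof.
move=> zz <-; transitivity (z * z * x - x * (z * z)); last first.
  by rewrite mulrBr mulrBl !mulrA addrA subrK.
rewrite zz mulrDl mulrDr mulr_natl mulr_natr opprD addrACA subrr addr0.
by rewrite mulrnAl mulrnAr mulrnBl.
Qed.

(** Up to degree n this is half the anticommutator of [sumZ] with [mono p q r], by
    [anticomm_sumZ]. *)
Definition mono_raise p q r : mx :=
  mono p q r.+1 *+ r.+1 + mono p q r.-1 *+ ((0 < r) * (n.+1 - (p + q + r))).

Definition anti_sumZ (M : mx) : mx := sumZ * M + M * sumZ.

Fact anti_sumZ_linear : linear anti_sumZ.
Proof.
move=> a M M'; rewrite /anti_sumZ mulrDl mulrDr.
by rewrite -[sumZ * (a *: M)]scalemxAr -[(a *: M) * sumZ]scalemxAl scalerDr addrACA.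
Qed.

HB.instance Definition _ := GRing.isLinear.Build _ mx mx _ anti_sumZ anti_sumZ_linear.

Lemma comm_mono002 p q r : (0 < n)%N -> (p + q + r <= n)%N ->
  mono 0 0 2 * mono p q r - mono p q r * mono 0 0 2 =
  (2 * 'i%C) *: (mono_raise p.-1 q.+1 r *+ ((0 < p) * q.+1)
                 - mono_raise p.+1 q.-1 r *+ ((0 < q) * p.+1)).
Proof.
move=> n_gt0 le_n; have nz : 2 != 0 :> R[i] by rewrite pnatr_eq0.
apply: (scalerI nz); rewrite [LHS]scaler_nat.
rewrite (comm_half_sqr (sumZ_sqr n_gt0) (comm_sumZ le_n)).
rewrite -/(anti_sumZ _) linearZ /= [RHS]scalerA [2 * (2 * _)]mulrC -[RHS]scalerA.
congr (_ *: _).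
rewrite linearB scalerBr !(linearMn anti_sumZ) /=; congr (_ - _).
  case: p le_n => [|p] le_n; first by rewrite !mulr0n scaler0.
  by rewrite [anti_sumZ _]anticomm_sumZ ?scalerMnr //=; lia.
case: q le_n => [|q] le_n; first by rewrite !mulr0n scaler0.
by rewrite [anti_sumZ _]anticomm_sumZ ?scalerMnr //=; lia.
Qed.

Lemma tr_mono p q r g : \tr (mono p q r *m string g) =
  (if has_type (ptype p q r) g then (2 ^ n)%:R else 0).
Proof.
rewrite /mono /type_sum mulmx_suml linear_sum /=.
under eq_bigr do rewrite tr_string.
rewrite -big_mkcondr /=; case: ifP => tg.
  by rewrite (big_pred1 g) // => f /=; case: eqVneq => [->|]; rewrite ?tg ?andbF.
by rewrite big_pred0 // => f /=; case: eqVneq => [->|]; rewrite ?tg ?andbF.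
Qed.

Definition canonical_word p q r : word :=
  [ffun k : 'I_n => nth pI (nseq p pX ++ nseq q pY ++ nseq r pZ ++
     nseq (n - (p + q + r)) pI) k].

Lemma has_type_canonical_word p q r p' q' r' : (p + q + r <= n)%N ->
  (p' + q' + r' <= n)%N ->
  has_type (ptype p' q' r') (canonical_word p q r) = [&& p' == p, q' == q & r' == r].
Proof.
move=> le_n le_n'.
set w := nseq p pX ++ nseq q pY ++ nseq r pZ ++ nseq (n - (p + q + r)) pI.
have sz : size w = n by rewrite !size_cat !size_nseq; lia.
have cw c : letter_count c (canonical_word p q r) = ptype p q r c.
  transitivity (count (pred1 c) w).
    rewrite -sum1_count (big_nth pI) sz big_mkord /letter_count -sum1_card.
    by apply: eq_bigl => k; rewrite !inE ffunE.
  by rewrite !count_cat !count_nseq; case: c => [[] []] /=; lia.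
apply/forallP/and3P => [H | [/eqP-> /eqP-> /eqP->] c]; last by rewrite cw.
by split; rewrite eq_sym; [have := H pX | have := H pY | have := H pZ]; rewrite cw.
Qed.

(** * The symbols X^p Y^q Z^r, their brackets and their coordinates *)

Local Notation XYZ := (XYZ R n).

(** If both factors are nontrivial then [i] and [j] carry different letters, hence are different
    qubits. *)
Lemma comm_onset (a b : letter) f i j : a != b ->
  (if f i == a then oq (pauli R a) i else 1) *
  (if f j == b then oq (pauli R b) j else 1) =
  (if f j == b then oq (pauli R b) j else 1) *
  (if f i == a then oq (pauli R a) i else 1).
Proof.
have [fi|_] := eqVneq (f i) a; last by rewrite mul1r mulr1.
have [fj|_] := eqVneq (f j) b; last by rewrite mul1r mulr1.
move=> neq_ab; apply: on_qubit_comm; apply: contra neq_ab => /eqP eq_ij.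
by rewrite -fi -fj eq_ij.
Qed.

Lemma on_setE f :
  on_set (pauliX R) [set k | f k == pX] * on_set (pauliY R) [set k | f k == pY]
  * on_set (pauliZ R) [set k | f k == pZ] = string f.
Proof.
have onE a : on_set (pauli R a) [set k | f k == a] =
    \prod_k (if f k == a then oq (pauli R a) k else 1).
  by rewrite /on_set big_mkcond; apply: eq_bigr => k _; rewrite inE.
rewrite (onE pX) (onE pY) (onE pZ) -prodrM_comm => [|i j _ _]; last first.
  exact: comm_onset.
rewrite -prodrM_comm => [|i j _ _]; last first.
  by apply/commr_sym/commrM; apply/commr_sym/comm_onset.
apply: eq_bigr => k _; case: (f k) => [[] []]; rewrite /= ?mul1r ?mulr1 //.
by rewrite on_qubit1.
Qed.

(** The number of letters I is forced, since all four counts add up to n. *)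
Lemma has_typeE p q r f :
  has_type (ptype p q r) f =
  [&& letter_count pX f == p, letter_count pY f == q & letter_count pZ f == r].
Proof.
apply/forallP/and3P => [H | [/eqP p_f /eqP q_f /eqP r_f] [[] []]] /=;
  rewrite ?p_f ?q_f ?r_f //.
by have := sum_letter_count f; rewrite p_f q_f r_f; lia.
Qed.

Lemma XYZE p q r : XYZ p q r = 'i%C *: mono p q r :> mx.
Proof.
rewrite /Defs.XYZ; congr (_ *: _).
under eq_bigr do rewrite pair_big_dep.
rewrite pair_big_dep /=.
(* Words correspond to triples of disjoint sets: [h] takes the supports of X, Y and Z, and [h']
   rebuilds the word. Disjointness makes [h'] a right inverse too. *)
pose h f := ([set k | f k == pX], ([set k | f k == pY], [set k | f k == pZ])).
pose h' (u : {set 'I_n} * ({set 'I_n} * {set 'I_n})) : word :=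
  [ffun k => if k \in u.1 then pX else if k \in u.2.1 then pY
             else if k \in u.2.2 then pZ else pI].
have hK : cancel h h'.
  by move=> f; apply/ffunP => k; rewrite !ffunE !inE /=; case: (f k) => [[] []].
rewrite (reindex_onto h h') /=; last first.
  move=> [A [B D]] /= /and4P[_ /andP[_ AB]].
  rewrite -!setI_eq0 => _ /andP[/eqP/setP AD /eqP/setP BD].
  move: AB; rewrite -setI_eq0 => /eqP/setP AB.
  congr (_, (_, _)); apply/setP => k; rewrite !inE ffunE /=;
  move: (AB k) (AD k) (BD k); rewrite !inE;
  by case: (k \in A); case: (k \in B); case: (k \in D).
apply: eq_big => [f | f _]; last exact: on_setE.
rewrite hK eqxx andbT has_typeE /h /=.
have dis (a b : letter) : a != b -> [disjoint [set k | f k == a] & [set k | f k == b]].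
  move=> neq_ab; rewrite -setI_eq0; apply/eqP/setP => k; rewrite !inE.
  by case: eqVneq => [->|//]; rewrite (negPf neq_ab).
by rewrite !cardsE !dis //= !andbT.
Qed.

Lemma mixerE : (0 < n)%N -> mixer R n = XYZ 1 0 0.
Proof. by move=> n_gt0; rewrite XYZE mono100. Qed.

(** [sumZ * sumZ] runs over all ordered pairs: the diagonal contributes n and the two triangular
    halves agree. Comparison with [sumZ_sqr] gives the claim. *)
Lemma sum_pairs : (0 < n)%N ->
  \sum_(j < n) \sum_(k < n | (j < k)%N) (oq (pauliZ R) j * oq (pauliZ R) k)
  = mono 0 0 2.
Proof.
move=> n_gt0; have nz : 2 != 0 :> R[i] by rewrite pnatr_eq0.
apply: (scalerI nz); rewrite [LHS]scaler_nat [RHS]scaler_nat.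
apply: (addIr n%:R); rewrite -sumZ_sqr //.
pose z j := oq (pauliZ R) j; rewrite -!/(z _).
have zC i j : z i * z j = z j * z i.
  by have [->//|neq_ij] := eqVneq i j; apply: on_qubit_comm.
have -> : sumZ * sumZ = \sum_(j < n) (\sum_(k < n | (j < k)%N) z j * z k
     + (\sum_(k < n | (k < j)%N) z j * z k + 1)).
  rewrite mulr_suml; apply: eq_bigr => j _; rewrite mulr_sumr.
  rewrite (bigID (fun k : 'I_n => (j < k)%N)) /=; congr (_ + _).
  rewrite (bigID (fun k : 'I_n => (k < j)%N)) /=; congr (_ + _).
    apply: eq_bigl => k; apply/andP/idP => [[]//|lt_kj].
    by split=> //; rewrite -leqNgt ltnW.
  rewrite (big_pred1 j) => [|k /=]; last by rewrite -!leqNgt -eqn_leq.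
  by rewrite on_qubitM (pauli_sqr R pZ) on_qubit1.
rewrite !big_split /= sumr_const card_ord addrA mulr2n; congr (_ + _ + _).
rewrite [RHS](exchange_big_dep predT) //=.
by apply: eq_bigr => j _; apply: eq_bigr => k _; rewrite -!/(z _) zC.
Qed.

Lemma phase_separatorE : (0 < n)%N -> phase_separator R n = XYZ 0 0 2.
Proof. by move=> n_gt0; rewrite XYZE -sum_pairs. Qed.

Lemma XYZ0 p q r : (n < p + q + r)%N -> XYZ p q r = 0.
Proof. by move=> lt_n; rewrite XYZE mono0 // [LHS]scaler0. Qed.

Lemma lie_iscale (A B : mx) :
  lie ('i%C *: A : Defs.realmx R _) ('i%C *: B : Defs.realmx R _)
  = - (A * B - B * A) :> mx.
Proof.
rewrite /lie -!scalemxAl -!scalemxAr !scalerA -expr2 sqr_i !scaleN1r.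
by rewrite [RHS]opprB addrC opprK.
Qed.

(** Bracketing with X^1 preserves the degree p + q + r. Above degree n each term vanishes or has
    coefficient 0, so the formula needs no range condition. *)
Lemma lie_X p q r : lie (XYZ 1 0 0) (XYZ p q r) =
  (XYZ p q.+1 r.-1 *+ ((0 < r) * q.+1) - XYZ p q.-1 r.+1 *+ ((0 < q) * r.+1)) *+ 2.
Proof.
have [le_n|lt_n] := leqP (p + q + r) n; last first.
  rewrite (XYZ0 lt_n) linear0; case: q r lt_n => [|q] [|r] lt_n;
  by rewrite ?mul0n ?mulr0n ?XYZ0 ?mul0rn ?subrr ?mul0rn //=; lia.
have [n0|n_gt0] := posnP n.
  have -> : p = 0%N by lia. have -> : q = 0%N by lia. have -> : r = 0%N by lia.
  by rewrite XYZ0 ?n0 // -/(lier _ _) linear0 subrr mul0rn.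
rewrite !XYZE [LHS]lie_iscale mono100 // comm_sumX //.
transitivity (('i%C *: mono p q.+1 r.-1 *+ ((0 < r) * q.+1)
   - 'i%C *: mono p q.-1 r.+1 *+ ((0 < q) * r.+1)) *+ 2 : mx); last by [].
rewrite -scalerN opprB mulrC -scalerA scaler_nat -scalerMnr; congr (_ *+ _).
by rewrite scalerBr !scalerMnr.
Qed.

Definition XYZraise p q r : Defs.realmx R (2 ^ n) :=
  XYZ p q r.+1 *+ r.+1 + XYZ p q r.-1 *+ ((0 < r) * (n.+1 - (p + q + r))).

(** When p + q + r = n + 1 the lowered symbol has degree n and need not vanish; its truncated
    coefficient is 0. *)
Lemma XYZraise0 p q r : (n < p + q + r)%N -> XYZraise p q r = 0.
Proof.
move=> lt_n; rewrite /XYZraise XYZ0 ?mul0rn ?add0r; last by lia.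
by rewrite (_ : _ - _ = 0)%N ?muln0 //; lia.
Qed.

Lemma XYZraiseE p q r : XYZraise p q r = 'i%C *: mono_raise p q r :> mx.
Proof.
rewrite /XYZraise !XYZE.
transitivity ('i%C *: mono p q r.+1 *+ r.+1
  + 'i%C *: mono p q r.-1 *+ ((0 < r) * (n.+1 - (p + q + r))) : mx); first by [].
by rewrite !scalerMnr -scalerDr.
Qed.

Lemma lie_ZZ p q r : (0 < n)%N -> lie (XYZ 0 0 2) (XYZ p q r) =
  (XYZraise p.+1 q.-1 r *+ ((0 < q) * p.+1)
   - XYZraise p.-1 q.+1 r *+ ((0 < p) * q.+1)) *+ 2.
Proof.
move=> n_gt0; have [le_n|lt_n] := leqP (p + q + r) n; last first.
  have out p' q' (b : bool) (l : nat) : (b -> p' + q' = p + q)%N ->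
      XYZraise p' q' r *+ (b * l) = 0.
    by case: b => // /(_ isT) eq_pq; rewrite XYZraise0 ?mul0rn //; lia.
  by rewrite (XYZ0 lt_n) linear0 !out ?subrr ?mul0rn //; lia.
rewrite !XYZE !XYZraiseE [LHS]lie_iscale comm_mono002 //.
transitivity (('i%C *: mono_raise p.+1 q.-1 r *+ ((0 < q) * p.+1)
   - 'i%C *: mono_raise p.-1 q.+1 r *+ ((0 < p) * q.+1)) *+ 2 : mx); last by [].
rewrite -scalerN opprB mulrC -scalerA scaler_nat -scalerMnr; congr (_ *+ _).
by rewrite scalerBr !scalerMnr.
Qed.

(** Pauli strings are orthogonal for the trace form, so pairing with one word of type [u] reads off
    a coefficient. The imaginary part strips the factor ['i%C] of the symbols. *)
Definition coordXYZ (u : nat * nat * nat) (A : Defs.realmx R (2 ^ n)) : R^o :=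
  complex.Im (\tr (A *m string (canonical_word u.1.1 u.1.2 u.2))) / (2 ^ n)%:R.

Fact coordXYZ_linear u : linear (coordXYZ u).
Proof.
move=> a A B; rewrite /coordXYZ mulmxDl mxtraceD.
set g := string _; rewrite (_ : (a *: A) *m g = a%:C%C *: (A *m g)); last first.
  by rewrite -scalemxAl.
rewrite mxtraceZ; case: (\tr _) => x y; case: (\tr _) => z w /=.
by rewrite mul0r addr0 mulrDl -mulrA.
Qed.

HB.instance Definition _ u := GRing.isLinear.Build R (Defs.realmx R (2 ^ n)) R^o _
  (coordXYZ u) (coordXYZ_linear u).

Lemma coordXYZE p q r p' q' r' : (p + q + r <= n)%N ->
  coordXYZ (p, q, r) (XYZ p' q' r') = ((p', q', r') == (p, q, r))%:R.
Proof.
move=> le_n; have [le_n'|lt_n] := leqP (p' + q' + r') n; last first.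
  rewrite (XYZ0 lt_n) linear0; case: eqP => // -[pp qq rr]; lia.
rewrite /coordXYZ XYZE -scalemxAl mxtraceZ tr_mono.
rewrite has_type_canonical_word //= !xpair_eqE -andbA.
case: ifP => _; last by rewrite mulr0 mul0r.
rewrite -(rmorph_nat (@real_complex R)) /= mul0r mul1r add0r mulfV //.
by rewrite pnatr_eq0 expn_eq0.
Qed.

End Types.

(** * Linear algebra of the bracket formulas *)

(** Given a linear relation, strong induction on [ord]: [phi i] leaves the diagonal term and terms
    of smaller [ord], whose coefficients are already zero. *)
Lemma free_triangular (K : fieldType) (V : vectType K) (T : eqType) (s : seq T)
    (v : T -> V) (phi : T -> V -> K) (ord : T -> nat) :
    uniq s -> (forall i a u w, phi i (a *: u + w) = a * phi i u + phi i w) ->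
    {in s, forall i, phi i (v i) != 0} ->
    {in s &, forall i j, i != j -> phi i (v j) != 0 -> (ord j < ord i)%N} ->
  free [seq v i | i <- s].
Proof.
case: s => [|i0 s']; first by rewrite nil_free.
set s := i0 :: s' => s_uniq phi_lin phi_diag phi_tri.
suff : free (map_tuple v (in_tuple s)) by [].
apply/freeP => k k0.
have phi0 i : phi i 0 = 0.
  by have := phi_lin i (-1) 0 0; rewrite scaler0 addr0 mulN1r addNr.
have phi_sum i : \sum_(j < size s) k j * phi i (v (nth i0 s j)) = 0.
  have phiD u w : phi i (u + w) = phi i u + phi i w.
    by rewrite -{1}[u]scale1r phi_lin mul1r.
  transitivity (phi i (\sum_j k j *: (map_tuple v (in_tuple s))`_j)).
    2: by rewrite k0.
  rewrite (big_morph (phi i) phiD (phi0 i)); apply: eq_bigr => j _.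
  by rewrite -[_ *: _]addr0 phi_lin phi0 addr0 (nth_map i0).
move=> j; have [d] := ubnP (ord (nth i0 s j)); elim: d j => // d IHd j lt_d.
have sj (l : 'I_(size s)) : nth i0 s l \in s by rewrite mem_nth.
have := phi_sum (nth i0 s j); rewrite (bigD1 j) //= big1 ?addr0 => [|l neq_lj].
  by move/eqP; rewrite mulf_eq0 (negPf (phi_diag _ (sj j))) orbF => /eqP.
have [->|nz] := eqVneq (phi (nth i0 s j) (v (nth i0 s l))) 0; first by rewrite mulr0.
rewrite IHd ?mul0r // -ltnS (leq_trans _ lt_d) // ltnS.
apply: phi_tri nz => //; rewrite nth_uniq //.
by apply: contra neq_lj => /eqP/val_inj ->.
Qed.

(** * The index set of the basis and its size *)

Definition simplex2 k : seq (nat * nat) :=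
  [seq (b, c) | b <- iota 0 k, c <- iota 0 (k - b)].

Definition simplex3 k : seq (nat * nat * nat) :=
  [seq (a, t.1, t.2) | a <- iota 0 k, t <- simplex2 (k - a)].

Lemma mem_simplex2 k b c : ((b, c) \in simplex2 k) = (b + c < k)%N.
Proof.
apply/allpairsPdep/idP => [[b' [c' []]]|lt_k].
  by rewrite !mem_iota => ? ? [-> ->]; lia.
by exists b, c; split; rewrite ?mem_iota //; lia.
Qed.

Lemma mem_simplex3 k a b c : ((a, b, c) \in simplex3 k) = (a + b + c < k)%N.
Proof.
apply/allpairsPdep/idP => [[a' [[b' c'] []]]|lt_k].
  by rewrite mem_iota mem_simplex2 => ? ? [-> -> ->]; lia.
by exists a, (b, c); split; rewrite ?mem_iota ?mem_simplex2 //; lia.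
Qed.

Lemma simplex2_uniq k : uniq (simplex2 k).
Proof.
apply: allpairs_uniq_dep => [|b _|]; rewrite ?iota_uniq //.
by move=> [b c] [b' c'] _ _ /= [-> ->].
Qed.

Lemma simplex3_uniq k : uniq (simplex3 k).
Proof.
apply: allpairs_uniq_dep => [|a _|]; rewrite ?iota_uniq ?simplex2_uniq //.
by move=> [a [b c]] [a' [b' c']] _ _ /= [-> -> ->].
Qed.

(** Shifting the index turns the sum over slices into a recursion on [k], from which the simplex
    sizes follow. *)
Lemma sumn_iota_subn f k :
  sumn [seq f (k.+1 - a)%N | a <- iota 0 k.+1] =
  (f k.+1 + sumn [seq f (k - a)%N | a <- iota 0 k])%N.
Proof.
rewrite /= subn0; congr (_ + sumn _)%N.
by rewrite (iotaDl 1 0) -map_comp; apply: eq_map.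
Qed.

Lemma size_simplex2 k : (2 * size (simplex2 k) = k * k.+1)%N.
Proof.
rewrite size_allpairs_dep; under eq_map do rewrite size_iota.
by elim: k => // k IHk; rewrite (sumn_iota_subn id) mulnDr IHk /=; lia.
Qed.

Lemma size_simplex3 k : (6 * size (simplex3 k) = k * k.+1 * k.+2)%N.
Proof.
rewrite size_allpairs_dep; elim: k => // k IHk.
rewrite (sumn_iota_subn (fun j => size (simplex2 j))) mulnDr IHk.
by have := size_simplex2 k.+1; lia.
Qed.

(* Parities are absorbed by halving all exponents.  The tag 0 stands for the
   symbols of parities (e,o,o), 1 for (o,e,e), 2 for (o,o,o), 3 and 4 for Z^2 and
   Y^2, 5 for L_1 and 6 for L_2. *)
Definition index_fam m k : seq (nat * nat * nat) :=
  match k with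
  | 0 | 1 => simplex3 m
  | 2 => simplex3 m.-1
  | 3 | 4 => [:: (0, 0, 0)]
  | 5 => rem (0, 0, 0) (simplex3 m)
  | _ => [seq (t.1, 0, t.2) | t <- simplex2 m.-1]
  end%N.

Definition basis_index m : seq (nat * (nat * nat * nat)) :=
  [seq (k, t) | k <- iota 0 7, t <- index_fam m k].

Lemma basis_index_uniq m : uniq (basis_index m).
Proof.
apply: allpairs_uniq_dep => [//|k _|]; last by move=> [k t] [k' t'] _ _ /= [-> ->].
case: k => [|[|[|[|[|[|k]]]]]] //=; rewrite ?simplex3_uniq ?rem_uniq ?simplex3_uniq //.
by rewrite map_inj_uniq ?simplex2_uniq // => -[b c] [b' c'] [-> ->].
Qed.

(** With n = 2m, the bounds say that the symbols, or those bracketed for tags 5 and 6, have degree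
    at most n: the degree is 2(a+b+c) plus 2 for parities (e,o,o), 1 for (o,e,e) and 3 for
    (o,o,o). *)
Lemma mem_basis_index m k a b c : (k, (a, b, c)) \in basis_index m =
  match k with
  | 0 | 1 => a + b + c < m
  | 2 => a + b + c < m.-1
  | 3 | 4 => (a, b, c) == (0, 0, 0)
  | 5 => ((a, b, c) != (0, 0, 0)) && (a + b + c < m)
  | 6 => (b == 0) && (a + c < m.-1)
  | _ => false
  end%N.
Proof.
transitivity ((k < 7)%N && ((a, b, c) \in index_fam m k)).
  apply/allpairsPdep/andP => [[k' [t' [+ + [-> ->]]]]|[lt_k tk]]; rewrite ?mem_iota //.
  by exists k, (a, b, c); rewrite mem_iota.
case: k => [|[|[|[|[|[|[|k]]]]]]] //=; rewrite ?mem_simplex3 ?inE //.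
  by rewrite mem_rem_uniq ?simplex3_uniq // inE mem_simplex3.
apply/mapP/andP => [[[a' c']]|[/eqP-> lt_m]].
  by rewrite mem_simplex2 => ? [-> -> ->].
by exists (a, c); rewrite ?mem_simplex2.
Qed.

Lemma size_basis_index m : (0 < m)%N ->
  (size (basis_index m) = 3 * size (simplex3 m) + size (simplex3 m.-1)
     + size (simplex2 m.-1) + 1)%N.
Proof.
move=> m_gt0; rewrite size_allpairs_dep /= size_rem; last by rewrite mem_simplex3.
have : (0 < size (simplex3 m))%N.
  by rewrite -has_predT; apply/hasP; exists (0, 0, 0)%N; rewrite ?mem_simplex3.
rewrite size_map; case: (size (simplex3 m)) => // s _ /=; lia.
Qed.

Section Combinatorics.
Variables (K : numFieldType) (V : vectType K) (n : nat).
Variables (x : nat -> nat -> nat -> V) (adX adZ : {linear V -> V}).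

(** The expression [XYZraise] over an abstract family [x]: matrices enter this section only through
    the hypotheses on [x], [adX], [adZ] and later [coord]. *)
Definition raise_by p q r :=
  x p q r.+1 *+ r.+1 + x p q r.-1 *+ ((0 < r) * (n.+1 - (p + q + r))).

Hypothesis x_eq0 : forall p q r, (n < p + q + r)%N -> x p q r = 0.
Hypothesis adXE : forall p q r, adX (x p q r) =
  (x p q.+1 r.-1 *+ ((0 < r) * q.+1) - x p q.-1 r.+1 *+ ((0 < q) * r.+1)) *+ 2.
Hypothesis adZE : forall p q r, adZ (x p q r) =
  (raise_by p.+1 q.-1 r *+ ((0 < q) * p.+1)
   - raise_by p.-1 q.+1 r *+ ((0 < p) * q.+1)) *+ 2.

Lemma memvMn (U : {vspace V}) k v : (0 < k)%N -> (v *+ k \in U) = (v \in U).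
Proof.
move=> k_gt0; rewrite -scaler_nat; apply/idP/idP => [|/memvZ-> //].
by move/(memvZ k%:R^-1); rewrite scalerA mulVf ?scale1r // pnatr_eq0 -lt0n.
Qed.

Lemma memv_muln (U : {vspace V}) v k : v \in U -> v *+ k \in U.
Proof. by move=> Uv; rewrite -scaler_nat memvZ. Qed.

Lemma memv_mulnb (U : {vspace V}) v (b : bool) k : (b -> v \in U) -> v *+ (b * k) \in U.
Proof. by case: b => [/(_ isT)/memv_muln|_]; rewrite ?mem0v. Qed.

Let adXB u v : adX (u - v) = adX u - adX v. Proof. exact: raddfB. Qed.
Let adXMn u k : adX (u *+ k) = adX u *+ k. Proof. exact: raddfMn. Qed.

(** * Subspaces stable under ad X^1 and ad Z^2 *)

Section Stable.
Variable U : {vspace V}.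
Hypothesis UX : forall v, v \in U -> adX v \in U.
Hypothesis UZ : forall v, v \in U -> adZ v \in U.

Lemma stableX p q r : x p q r \in U ->
  x p q.+1 r.-1 *+ ((0 < r) * q.+1) - x p q.-1 r.+1 *+ ((0 < q) * r.+1) \in U.
Proof. by move=> /UX; rewrite adXE memvMn. Qed.

Lemma stableZ p q r : x p q r \in U ->
  raise_by p.+1 q.-1 r *+ ((0 < q) * p.+1)
   - raise_by p.-1 q.+1 r *+ ((0 < p) * q.+1) \in U.
Proof. by move=> /UZ; rewrite adZE memvMn. Qed.

(* The square of [adX] moves along the line [q + r = const] in steps of 2. *)
Lemma rotate2 p q r : x p q r.+2 \in U ->
  ((1 < q)%N -> x p q.-2 r.+4 \in U) -> x p q.+2 r \in U.
Proof.
move=> xU prevU; have := UX (UX xU).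
rewrite adXE mul1n adXMn memvMn // adXB !adXMn.
rewrite rpredBr; last first.
  case: q xU prevU => [|q] xU prevU; first by rewrite mul0n mulr0n mem0v.
  apply: memv_muln; rewrite /= adXE; apply: memv_muln; apply: rpredB.
    exact: memv_muln.
  by apply: memv_mulnb.
rewrite memvMn // adXE memvMn // mul1n.
by rewrite rpredBr ?memvMn // memv_muln.
Qed.

(** Iterates [rotate2] from [q0], each step using the two preceding points of the line; [q0 < 2]
    ensures that the first step has no predecessor. *)
Lemma rotate p q0 k r : (q0 < 2)%N -> x p q0 (r + k.*2) \in U ->
  x p (q0 + k.*2) r \in U.
Proof.
move=> lt_q0; elim/ltn_ind: k r => -[|k] IHk r; first by rewrite !addn0.
rewrite doubleS !addnS => base; apply: rotate2.
  by apply: (IHk k) => //; rewrite !addSn.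
case: k IHk base => [|k] IHk base.
  by rewrite addn0; case: q0 lt_q0 {base IHk} => [|[]].
move=> _; rewrite doubleS !addnS /=; apply: (IHk k) => //.
by move: base; rewrite doubleS !addSn !addnS.
Qed.

Lemma raise_mem p q r : x p q r.+1 \in U -> ((0 < r)%N -> x p q r.-1 \in U) ->
  raise_by p q r \in U.
Proof.
by move=> hi lo; apply: rpredD; [apply: memv_muln | apply: memv_mulnb].
Qed.

Lemma raise_up p q r : raise_by p q r \in U -> ((0 < r)%N -> x p q r.-1 \in U) ->
  x p q r.+1 \in U.
Proof.
move=> hr lo; rewrite -(@memvMn _ r.+1) //.
rewrite -(rpredDr (x := x p q r.-1 *+ ((0 < r) * (n.+1 - (p + q + r))))) //.
exact: memv_mulnb.
Qed.

(** The coefficient of the lower symbol is n - (p + q + r), which is nonzero below the top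
    degree. *)
Lemma raise_down p q r : (p + q + r < n)%N -> raise_by p q r.+1 \in U ->
  x p q r.+2 \in U -> x p q r \in U.
Proof.
move=> lt_n hr hi; move: hr; rewrite rpredDl ?(memv_muln _ hi) // mul1n memvMn //.
by rewrite addnS subSS subn_gt0.
Qed.

Hypothesis U100 : x 1 0 0 \in U.
Hypothesis U002 : x 0 0 2 \in U.
Hypothesis n_even : ~~ odd n.

(** [rowA] is used for even [p] and [rowB] for odd [p], that is for parities (e,o,o) and (o,e,e). *)
Let rowA p := forall q r, x p q.*2.+1 r.*2.+1 \in U.
Let rowB p := forall q r, x p q.*2 r.*2 \in U.

Let rowA1 p : (forall r, x p 1 r.*2.+1 \in U) -> rowA p.
Proof.
move=> H q r; rewrite -[q.*2.+1]add1n; apply: rotate => //.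
by rewrite addSn -doubleD.
Qed.

Let rowB0 p : (forall r, x p 0 r.*2 \in U) -> rowB p.
Proof.
move=> H q r; rewrite -[q.*2]add0n; apply: rotate => //.
by rewrite -doubleD.
Qed.

(** A ladder starting from (1,0,0) and [X^1, Z^2]: ad Z^2 leads from (0,1,2k+1) to (1,0,2k+2) and
    from there to (0,1,2k+3), modulo symbols already reached. *)
Let row0 : rowA 0 /\ rowB 1.
Proof.
have base k : x 1 0 k.*2 \in U /\ x 0 1 k.*2.+1 \in U.
  elim: k => [|k [Bk Ak]].
    by split=> //; have := stableX U002; rewrite mul0n mulr0n subr0.
  have Bk1 : x 1 0 k.+1.*2 \in U.
    have := stableZ Ak; rewrite mul0n mulr0n subr0 memvMn // => /raise_up; exact.
  split=> //; have := stableZ Bk1; rewrite mul0n mulr0n sub0r rpredN memvMn //.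
  by move/raise_up; apply.
by split; [apply: rowA1 => r; case: (base r) | apply: rowB0 => r; case: (base r)].
Qed.

(** ad Z^2 applied to (p+1,2,2k) yields terms with first exponent p, which lie in row p, and terms
    (p+2,1,2k+1) and (p+2,1,2k-1). Induction on k isolates the first of these. *)
Let rowA_next p : rowA p -> rowB p.+1 -> rowA p.+2.
Proof.
move=> HA HB; apply: rowA1; elim=> [|k IHk].
  have := stableZ (HB 1%N 0%N); rewrite /= rpredBr ?memvMn //.
    by move/raise_up; apply.
  apply: raise_mem => //; exact: (HA 1%N 0%N).
have := stableZ (HB 1%N k.+1); rewrite /= rpredBr ?memvMn //.
  by move/raise_up; apply.
apply: raise_mem; first exact: (HA 1%N k.+1).
by move=> _; apply: (HA 1%N k).
Qed.

(* Evenness of [n] enters here: at the top degree the degree-raising half of the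
   bracket vanishes, which starts a descending induction on [k]. *)
Let rowB_next p : ~~ odd p -> rowA p.+2 -> rowB p.+1 -> rowB p.+3.
Proof.
move=> p_even HA HB; apply: rowB0 => k.
have [d] := ubnP (n - (p + k.*2)); elim: d k => // d IHd k lt_d.
have [lt_n|le_n] := ltnP n (p.+3 + 0 + k.*2); first by rewrite x_eq0 // mem0v.
have lt_n : (p.+3 + 0 + k.*2 < n)%N.
  rewrite ltn_neqAle le_n andbT; apply: contra n_even => /eqP <-.
  by rewrite addn0 /= oddD odd_double negbK (negPf p_even).
apply: (raise_down lt_n); last first.
  by rewrite -doubleS; apply: IHd; lia.
have := stableZ (HA 0%N k); rewrite /= rpredBr ?memvMn //.
apply: raise_mem; first exact: (HB 1%N k.+1).
by move=> _; apply: (HB 1%N k).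
Qed.

Let rows a : rowA a.*2 /\ rowB a.*2.+1.
Proof.
elim: a => [|a [HA HB]]; first exact: row0.
have HA' : rowA a.+1.*2 by rewrite doubleS; apply: rowA_next.
by split=> //; rewrite doubleS; apply: rowB_next => //; rewrite ?odd_double.
Qed.

Lemma stable_eoo a b c : x a.*2 b.*2.+1 c.*2.+1 \in U.
Proof. by case: (rows a). Qed.

Lemma stable_oee a b c : x a.*2.+1 b.*2 c.*2 \in U.
Proof. by case: (rows a). Qed.

(** ad X^1 of a symbol (o,0,e) is a multiple of a symbol (o,1,o), from which the others are
    rotated. *)
Lemma stable_ooo a b c : x a.*2.+1 b.*2.+1 c.*2.+1 \in U.
Proof.
rewrite -[b.*2.+1]add1n; apply: rotate => //.
rewrite addSn -doubleD; have := stableX (stable_oee a 0 (c + b).+1).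
by rewrite mul0n mulr0n subr0.
Qed.

Lemma stable_020 : x 0 2 0 \in U.
Proof.
by have := stableX (stable_eoo 0 0 0); rewrite /= rpredBr ?memvMn // memv_muln.
Qed.

End Stable.

(** * Subspaces closed under both brackets on the symbols *)

Section Closed.
Variable W : {vspace V}.
Hypothesis W_good : forall p q r, odd q = odd r -> odd p || odd q -> x p q r \in W.
Hypothesis W002 : x 0 0 2 \in W.
Hypothesis W020 : x 0 2 0 \in W.
Hypothesis W_adX : forall p q r, (p, q, r) != (0, 1, 1)%N ->
  ~~ odd p -> odd q -> odd r -> adX (x p q r) \in W.
Hypothesis W_adZ : forall p r, odd p -> odd r -> adZ (x p 1 r) \in W.

(** ad X^1 flips the parities of q and r, so only (e,o,o) leads out of the symbols of [W_good].
    There [W_adX] applies, except at (0,1,1), whose image combines Y^2 and Z^2. *)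
Lemma closed_adX p q r : odd q = odd r -> adX (x p q r) \in W.
Proof.
move=> qr; have [good|/norP[p_even]] := boolP (odd p || ~~ odd q); last first.
  rewrite negbK => q_odd; have r_odd : odd r by rewrite -qr.
  have [[-> -> ->]|neq] := eqVneq (p, q, r) (0, 1, 1)%N; last exact: W_adX.
  by rewrite adXE memv_muln // rpredB ?memv_muln.
rewrite adXE; apply/memv_muln/rpredB; apply: memv_mulnb.
  case: r qr => // r /= qr _; by apply: W_good; rewrite //= qr negbK.
case: q qr good => // q /= qr good _; apply: W_good => /=; first by rewrite -qr negbK.
by rewrite negbK in good.
Qed.

Definition eqW u v := u - v \in W.

Lemma eqWMn u v i j k l t : eqW (u *+ i) (v *+ j) ->
  (k = i * t)%N -> (l = j * t)%N -> eqW (u *+ k) (v *+ l).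
Proof. by move=> uv -> ->; rewrite /eqW !mulrnA -mulrnBl memv_muln. Qed.

Lemma eqWD u1 v1 u2 v2 : eqW u1 v1 -> eqW u2 v2 -> eqW (u1 + u2) (v1 + v2).
Proof. by move=> uv1 uv2; rewrite /eqW opprD addrACA rpredD. Qed.

Lemma eqWB u1 v1 u2 v2 : eqW u1 v1 -> eqW u2 v2 -> eqW (u1 - u2) (v1 - v2).
Proof.
move=> uv1 uv2; rewrite /eqW.
suff -> : u1 - u2 - (v1 - v2) = u1 - v1 - (u2 - v2) by exact: rpredB.
by rewrite !opprB [LHS]addrACA [RHS]addrACA [- u2 - v1]addrC.
Qed.

(** Both sides have the shape given by [adZE], so the comparison splits into four congruences
    between single symbols. *)
Lemma eqW_comb A1 B1 C1 D1 A2 B2 C2 D2 i1 i2 m m' j k1 k2 h s t :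
  eqW (A1 *+ (i1 * (j * (h * s)))) (A2 *+ (i2 * (j * (h * t)))) ->
  eqW (B1 *+ (m * (j * (h * s)))) (B2 *+ (m * (j * (h * t)))) ->
  eqW (C1 *+ (i1 * (k1 * (h * s)))) (C2 *+ (i2 * (k2 * (h * t)))) ->
  eqW (D1 *+ (m' * (k1 * (h * s)))) (D2 *+ (m' * (k2 * (h * t)))) ->
  eqW (((A1 *+ i1 + B1 *+ m) *+ j - (C1 *+ i1 + D1 *+ m') *+ k1) *+ h *+ s)
      (((A2 *+ i2 + B2 *+ m) *+ j - (C2 *+ i2 + D2 *+ m') *+ k2) *+ h *+ t).
Proof.
move=> HA HB HC HD; rewrite !(mulrnBl, mulrnDl) -!mulrnA.
by apply: eqWB; apply: eqWD.
Qed.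

(** This is the membership of ad X^1 (p, 2b+1, 2c+1) in [W], with the common factors divided out. *)
Lemma eqW_rotate p b c : ~~ odd p ->
  eqW (x p b.*2.+2 c.*2 *+ b.+1) (x p b.*2 c.*2.+2 *+ c.+1).
Proof.
move=> p_even; have := @closed_adX p b.*2.+1 c.*2.+1.
rewrite /= !odd_double => /(_ erefl); rewrite adXE memvMn // !mul1n /=.
by rewrite /eqW -[b.*2.+2]doubleS -[c.*2.+2]doubleS -!muln2 !mulrnA -mulrnBl memvMn.
Qed.

(* Modulo [W] the matrices [x p b.*2 c.*2] with [b + c] fixed are proportional
   with ratios given by binomial coefficients, and so are their brackets. *)
Lemma eqW_adZ p b c : odd p ->
  eqW (adZ (x p b.*2.+3 c.*2.+1) *+ b.+1) (adZ (x p b.*2.+1 c.*2.+3) *+ c.+1).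
Proof.
case: p => // p /= p_even; rewrite !adZE /raise_by !succnK !ltn0Sn !mul1n.
have -> : (p.+2 + b.*2.+2 + c.*2.+1 = p.+2 + b.*2 + c.*2.+3)%N by lia.
have -> : (p + b.*2.+4 + c.*2.+1 = p + b.*2.+2 + c.*2.+3)%N by lia.
have e : ~~ odd p.+2 by rewrite /= negbK.
apply: eqW_comb.
- by apply: (eqWMn (t := 4 * c.+1 * p.+2) (eqW_rotate b c.+1 e)); lia.
- set m := (n.+1 - _)%N.
  by apply: (eqWMn (t := m * p.+2 * 2) (eqW_rotate b c e)); lia.
- by apply: (eqWMn (t := 8 * c.+1 * b.+1) (eqW_rotate b.+1 c.+1 p_even)); lia.
- set m := (n.+1 - _)%N.
  by apply: (eqWMn (t := m * b.+1 * 4) (eqW_rotate b.+1 c p_even)); lia.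
Qed.

(** ad Z^2 flips all three parities, so only (o,o,o) fails to land in [W_good]. There [eqW_adZ]
    lowers q by 2 until q = 1, where [W_adZ] applies. *)
Lemma closed_adZ p q r : odd q = odd r -> adZ (x p q r) \in W.
Proof.
move=> qr; have [/andP[p_odd q_odd]|good] := boolP (odd p && odd q).
  have -> : q = q./2.*2.+1 by rewrite -[LHS]odd_double_half q_odd.
  have -> : r = r./2.*2.+1 by rewrite -[LHS]odd_double_half -qr q_odd.
  elim: q./2 r./2 => [|b IHb] c; first by apply: W_adZ; rewrite //= odd_double.
  have := eqW_adZ b c p_odd; rewrite /eqW rpredBr ?memvMn //.
  exact: (IHb c.+1).
have memr p' q' : odd q' = ~~ odd q -> odd p' || odd q' -> raise_by p' q' r \in W.
  move=> q'q good'; apply: rpredD; [apply: memv_muln | apply: memv_mulnb => r_gt0].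
    by apply: W_good; rewrite //= q'q qr.
  by apply: W_good; rewrite // q'q qr; case: r r_gt0 {qr} => //= r _; rewrite negbK.
rewrite adZE; apply/memv_muln/rpredB; apply: memv_mulnb.
  case: q good {qr} memr => // q good memr _; apply: memr => /=; first by rewrite negbK.
  by move: good; rewrite /= negb_and negbK.
case: p good => // p good _; apply: memr => //=.
by move: good; rewrite /= negb_and negbK.
Qed.

(** ad X^1 preserves the condition [odd q = odd r], so a further operator [T] needs to be known only
    on symbols. This handles second brackets on L_1, as [closed_adZ2] does on L_2. *)
Lemma closed_adX2 (T : {linear V -> V}) p q r :
  (forall p q r, odd q = odd r -> T (x p q r) \in W) ->
  odd q = odd r -> T (adX (x p q r)) \in W.
Proof.
move=> WT qr; rewrite adXE (raddfMn T) (raddfB T) !(raddfMn T).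
apply/memv_muln/rpredB; apply: memv_mulnb => gt0; apply: WT => /=.
  by rewrite qr; case: r gt0 {qr} => //= r _; rewrite negbK.
by rewrite -qr; case: q gt0 {qr} => //= q _; rewrite negbK.
Qed.

Lemma closed_adZ2 (T : {linear V -> V}) p q r :
  (forall p q r, odd q = odd r -> T (x p q r) \in W) ->
  odd q = odd r -> T (adZ (x p q r)) \in W.
Proof.
move=> WT qr; rewrite adZE (raddfMn T) (raddfB T) !(raddfMn T).
have memr p' q' : odd q' = ~~ odd q -> T (raise_by p' q' r) \in W.
  move=> q'q; rewrite (raddfD T) !(raddfMn T).
  apply: rpredD; [apply: memv_muln | apply: memv_mulnb => r_gt0]; apply: WT.
    by rewrite q'q qr.
  by rewrite q'q qr; case: r r_gt0 {qr} => //= r _; rewrite negbK.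
apply/memv_muln/rpredB; apply: memv_mulnb => gt0; apply: memr => //.
by case: q gt0 {qr} => //= q _; rewrite negbK.
Qed.

End Closed.

(** * The proposed basis and the stability of its span *)

Variable m : nat.
Hypothesis m_gt0 : (0 < m)%N.
Hypothesis n_m : n = m.*2.

Variable coord : nat * nat * nat -> {linear V -> K^o}.
Hypothesis coordE : forall p q r p' q' r', (p + q + r <= n)%N ->
  coord (p, q, r) (x p' q' r') = ((p', q', r') == (p, q, r))%:R.

Definition basis_vec (i : nat * (nat * nat * nat)) : V :=
  let: (k, (a, b, c)) := i in
  match k with
  | 0 => x a.*2 b.*2.+1 c.*2.+1
  | 1 => x a.*2.+1 b.*2 c.*2
  | 2 => x a.*2.+1 b.*2.+1 c.*2.+1
  | 3 => x 0 0 2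
  | 4 => x 0 2 0
  | 5 => adX (x a.*2 b.*2.+1 c.*2.+1)
  | _ => adZ (x a.*2.+1 1 c.*2.+1)
  end.

Definition basis_seq := [seq basis_vec i | i <- basis_index m].

Lemma basis_seq_stable (U : {vspace V}) :
  (forall v, v \in U -> adX v \in U) -> (forall v, v \in U -> adZ v \in U) ->
  x 1 0 0 \in U -> x 0 0 2 \in U -> {subset basis_seq <= U}.
Proof.
move=> UX UZ U100 U002 _ /mapP[[k [[a b] c]] _ ->].
have n_even : ~~ odd n by rewrite n_m odd_double.
have Ueoo := stable_eoo UX UZ U100 U002 n_even.
have Uooo := stable_ooo UX UZ U100 U002 n_even.
case: k => [|[|[|[|[|[|k]]]]]] //=.
- exact: (stable_oee UX UZ U100 U002 n_even).
- exact: (stable_020 UX UZ U100 U002 n_even).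
- exact: UX.
- by apply: UZ; apply: (Uooo a 0%N c).
Qed.

Local Notation W := <<basis_seq>>%VS.

Lemma mem_span_basis_vec k a b c :
  (k, (a, b, c)) \in basis_index m -> basis_vec (k, (a, b, c)) \in W.
Proof. by move=> ik; apply/memv_span/map_f. Qed.

Lemma span_good p q r : odd q = odd r -> odd p || odd q -> x p q r \in W.
Proof.
move=> qr good; have [lt_n|le_n] := ltnP n (p + q + r); first by rewrite x_eq0 ?mem0v.
have [[ep eq] er] := (odd_double_half p, odd_double_half q, odd_double_half r).
rewrite -ep -eq -er -qr; move: le_n; rewrite n_m -{1}ep -{1}eq -{1}er -qr.
move: good; case: (odd p); case: (odd q); rewrite ?add0n ?add1n => // _ le_n.
- by apply: (@mem_span_basis_vec 2 p./2 q./2 r./2); rewrite mem_basis_index /=; lia.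
- by apply: (@mem_span_basis_vec 1 p./2 q./2 r./2); rewrite mem_basis_index /=; lia.
- by apply: (@mem_span_basis_vec 0 p./2 q./2 r./2); rewrite mem_basis_index /=; lia.
Qed.

Lemma span_002 : x 0 0 2 \in W.
Proof. by apply: (@mem_span_basis_vec 3 0 0 0); rewrite mem_basis_index. Qed.

Lemma span_020 : x 0 2 0 \in W.
Proof. by apply: (@mem_span_basis_vec 4 0 0 0); rewrite mem_basis_index. Qed.

Lemma span_adX p q r : (p, q, r) != (0, 1, 1)%N ->
  ~~ odd p -> odd q -> odd r -> adX (x p q r) \in W.
Proof.
have [lt_n|le_n] := ltnP n (p + q + r); first by rewrite x_eq0 // linear0 mem0v.
move=> neq p_even q_odd r_odd.
have [[ep eq] er] := (odd_double_half p, odd_double_half q, odd_double_half r).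
move: neq le_n; rewrite -ep -eq -er (negPf p_even) q_odd r_odd add0n !add1n n_m.
move=> neq le_n.
apply: (@mem_span_basis_vec 5 p./2 q./2 r./2); rewrite mem_basis_index.
by apply/andP; split; [apply: contra neq => /eqP[-> -> ->] | lia].
Qed.

Lemma span_adZ p r : odd p -> odd r -> adZ (x p 1 r) \in W.
Proof.
have [lt_n|le_n] := ltnP n (p + 1 + r); first by rewrite x_eq0 // linear0 mem0v.
move=> p_odd r_odd; have [ep er] := (odd_double_half p, odd_double_half r).
move: le_n; rewrite -ep -er p_odd r_odd !add1n n_m => le_n.
by apply: (@mem_span_basis_vec 6 p./2 0 r./2); rewrite mem_basis_index /=; lia.
Qed.

Let WX := closed_adX span_good span_002 span_020 span_adX.
Let WZ := closed_adZ span_good span_002 span_020 span_adX span_adZ.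

Lemma span_stable (T : {linear V -> V}) :
  (forall p q r, odd q = odd r -> T (x p q r) \in W) ->
  forall v, v \in W -> T v \in W.
Proof.
move=> WT v vW; rewrite (coord_span (X := in_tuple basis_seq) vW) linear_sum.
apply: memv_suml => i _.
rewrite linearZ memvZ //; set u := nth _ _ _.
have /mapP[[k [[a b] c]] _ ->] : u \in basis_seq by apply: mem_nth.
case: k => [|[|[|[|[|[|k]]]]]] /=; try by apply: WT; rewrite /= ?odd_double ?odd_double.
  by apply: (@closed_adX2 W T _ _ _ WT); rewrite /= !odd_double.
by apply: (@closed_adZ2 W T _ _ _ WT); rewrite /= !odd_double.
Qed.

Lemma span_adX_stable v : v \in W -> adX v \in W.
Proof. exact: span_stable WX v. Qed.

Lemma span_adZ_stable v : v \in W -> adZ v \in W.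
Proof. exact: span_stable WZ v. Qed.

(** * Dual linear forms and freeness *)

(* Coefficients of a linear relation are eliminated by increasing rank. *)
Definition elim_rank (i : nat * (nat * nat * nat)) : nat :=
  match i.1 with
  | 0 | 1 | 2 => 0
  | 3 | 4 => n.+1
  | 5 => n.+2 + i.2.2
  | _ => i.2.2
  end.

Definition rotation_form P s (v : V) : K^o :=
  \sum_(j < s.+1) coord (P, j.*2, (s - j).*2)%N v * ('C(s, j))%:R.

Fact rotation_form_linear P s : linear (rotation_form P s).
Proof.
move=> a u v; rewrite /rotation_form scaler_sumr -big_split; apply: eq_bigr => j _ /=.
by rewrite linearP mulrDl /= -scalerAl.
Qed.

HB.instance Definition _ P s :=
  GRing.isLinear.Build K V K^o _ (rotation_form P s) (rotation_form_linear P s).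

(** For tag 5 the coordinate is that of the term in which a Z became a Y. For tag 6, the rotation
    form with s = c sees only (2a+2,0,2c), the one term of the bracket with q + r = 2c. *)
Definition dual_form (i : nat * (nat * nat * nat)) : V -> K :=
  let: (k, (a, b, c)) := i in
  match k with
  | 0 => coord (a.*2, b.*2.+1, c.*2.+1)
  | 1 => coord (a.*2.+1, b.*2, c.*2)
  | 2 => coord (a.*2.+1, b.*2.+1, c.*2.+1)
  | 3 => coord (0, 0, 2)
  | 4 => coord (0, 2, 0)
  | 5 => coord (a.*2, b.*2.+2, c.*2)
  | _ => rotation_form a.*2.+2 c
  end%N.

Lemma dual_form_linear i a u w :
  dual_form i (a *: u + w) = a * dual_form i u + dual_form i w.
Proof. by case: i => [[|[|[|[|[|[|k]]]]]] [[p q] r]] /=; rewrite linearP. Qed.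

(** Taking a plain function with a linearity proof covers coordinates, rotation forms and arbitrary
    forms at once. *)
Lemma linear_adX (f0 : V -> K^o) a b c (f := f0) : linear f0 ->
  f (adX (x a.*2 b.*2.+1 c.*2.+1)) =
  (f (x a.*2 b.*2.+2 c.*2) *+ b.*2.+2 - f (x a.*2 b.*2 c.*2.+2) *+ c.*2.+2) *+ 2.
Proof.
move=> f_lin.
pose g : {linear V -> K^o} := HB.pack f0 (GRing.isLinear.Build K V K^o *:%R f0 f_lin).
rewrite -[f]/(GRing.Linear.sort g).
by rewrite adXE (raddfMn g) (raddfB g) !(raddfMn g) !mul1n.
Qed.

Lemma linear_adZ (f0 : V -> K^o) a c (f := f0) : linear f0 ->
  f (adZ (x a.*2.+1 1 c.*2.+1)) =
  ((f (x a.*2.+2 0 c.*2.+2) *+ c.*2.+2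
    + f (x a.*2.+2 0 c.*2) *+ (n.+1 - (a.*2.+2 + 0 + c.*2.+1))) *+ a.*2.+2
   - (f (x a.*2 2 c.*2.+2) *+ c.*2.+2
    + f (x a.*2 2 c.*2) *+ (n.+1 - (a.*2 + 2 + c.*2.+1))) *+ 2) *+ 2.
Proof.
move=> f_lin.
pose g : {linear V -> K^o} := HB.pack f0 (GRing.isLinear.Build K V K^o *:%R f0 f_lin).
rewrite -[f]/(GRing.Linear.sort g).
have lin A B C D i j k l h e :
    g (((A *+ i + B *+ j) *+ k - (C *+ i + D *+ l) *+ h) *+ e) =
    ((g A *+ i + g B *+ j) *+ k - (g C *+ i + g D *+ l) *+ h) *+ e.
  by rewrite (raddfMn g) (raddfB g) !(raddfMn g) !(raddfD g) !(raddfMn g).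
by rewrite adZE /raise_by !mul1n lin.
Qed.

Lemma coord_neq0 p q r p' q' r' : (p + q + r <= n)%N ->
  coord (p, q, r) (x p' q' r') != 0 -> [/\ p' = p, q' = q & r' = r].
Proof. by move=> le_n; rewrite coordE // pnatr_eq0 eqb0 negbK => /eqP[]. Qed.

Lemma rotation_formE P s p b c : (P + s.*2 <= n)%N ->
  rotation_form P s (x p b.*2 c.*2) = ((p == P) && (b + c == s)%N)%:R * ('C(s, b))%:R.
Proof.
move=> le_n; rewrite /rotation_form; under eq_bigr => j _.
  rewrite coordE; last by have := ltn_ord j; lia.
  over.
have [/andP[/eqP-> /eqP eq_s]|neq] := boolP ((p == P) && _).
  have lt_b : (b < s.+1)%N by lia.
  rewrite (bigD1 (Ordinal lt_b)) //= big1 ?addr0 => [|j neq_j].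
    by rewrite (_ : (s - b) = c)%N ?eqxx //; lia.
  case: eqP => [[eq_b _]|]; last by rewrite mul0r.
  by case/eqP: neq_j; apply: val_inj => /=; lia.
rewrite mul0r big1 // => j _; case: eqP => [[eP eb ec]|]; last by rewrite mul0r.
have := ltn_ord j => lt_j; case/negP: neq; apply/andP; split; first exact/eqP.
by apply/eqP; lia.
Qed.

Lemma rotation_form_odd P s p q r : (P.*2 + s.*2 <= n)%N -> odd p || odd q || odd r ->
  rotation_form P.*2 s (x p q r) = 0.
Proof.
move=> le_n pqr_odd; apply: big1 => j _; rewrite coordE; last by have := ltn_ord j; lia.
case: eqP pqr_odd => [[-> -> ->]|_ _]; last by rewrite mul0r.
by rewrite !odd_double.
Qed.

(** The two terms cancel by (b+1) C(s,b+1) = (s-b) C(s,b), where s - b = c + 1 on the relevant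
    line. *)
Lemma rotation_form_adX P s a b c : (P + s.*2 <= n)%N ->
  rotation_form P s (adX (x a.*2 b.*2.+1 c.*2.+1)) = 0.
Proof.
move=> le_n; rewrite (linear_adX _ _ _ (rotation_form_linear P s)).
rewrite -![_.*2.+2]doubleS !(rotation_formE _ _ _ le_n).
rewrite addSn addnS; set e := _ && _.
have [/andP[_ /eqP eq_s]|_] := boolP e; last by rewrite !mul0r !mul0rn subrr mul0rn.
rewrite !mul1r -!mulrnA (_ : 'C(s, b.+1) * _ = 'C(s, b) * c.+1.*2)%N ?subrr ?mul0rn //.
rewrite -!muln2 !mulnA; congr (_ * _)%N.
by rewrite mulnC mul_bin_left mulnC; congr (_ * _)%N; lia.
Qed.

Let double_even k : odd k.*2 = false. Proof. exact: odd_double. Qed.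
Let double2_even k : odd k.*2.+2 = false. Proof. by rewrite -doubleS odd_double. Qed.

(** Every symbol in an L_1 vector has all exponents even; the same holds for L_2 in [even_adZ]. *)
Lemma even_adX (f : V -> K^o) a b c : linear f ->
  (forall p q r, odd p = false -> odd q = false -> odd r = false -> f (x p q r) = 0) ->
  f (adX (x a.*2 b.*2.+1 c.*2.+1)) = 0.
Proof.
move=> f_lin f0; rewrite linear_adX // !f0 ?double2_even ?double_even //.
by rewrite !mul0rn subrr mul0rn.
Qed.

Lemma even_adZ (f : V -> K^o) a c : linear f ->
  (forall p q r, odd p = false -> odd q = false -> odd r = false -> f (x p q r) = 0) ->
  f (adZ (x a.*2.+1 1 c.*2.+1)) = 0.
Proof.
move=> f_lin f0; rewrite linear_adZ // !f0 ?double2_even ?double_even //.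
by rewrite !mul0rn !addr0 !mul0rn subrr mul0rn.
Qed.

Lemma coord_adX p q r a b c : (p + q + r <= n)%N ->
  coord (p, q, r) (adX (x a.*2 b.*2.+1 c.*2.+1)) =
  (((a.*2, b.*2.+2, c.*2) == (p, q, r))%:R *+ b.*2.+2
   - ((a.*2, b.*2, c.*2.+2) == (p, q, r))%:R *+ c.*2.+2) *+ 2.
Proof.
by move=> le_n; rewrite (linear_adX _ _ _ (linearP (coord (p, q, r)))) !coordE.
Qed.

(** The terms of the bracket have (q + r)/2 equal to c, c+1 or c+2. As s <= c, only the first kind
    can contribute, and it needs c = s. *)
Lemma rotation_form_adZ a' s a c : (a'.*2.+2 + s.*2 <= n)%N -> (s <= c)%N ->
  rotation_form a'.*2.+2 s (adZ (x a.*2.+1 1 c.*2.+1)) =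
  ((a == a') && (c == s))%:R
    *+ ((n.+1 - (a.*2.+2 + 0 + c.*2.+1)) * (a.*2.+2 * 2)).
Proof.
move=> le_n le_sc.
rewrite (linear_adZ _ _ (rotation_form_linear _ s)).
rewrite -[c.*2.+2]doubleS -[0%N]/(0.*2) -[2%N]/(1.*2).
rewrite !(rotation_formE _ _ _ le_n).
have [e1 e2 e3] : [/\ (0 + c.+1 == s = false), (1 + c.+1 == s = false)
    & (1 + c == s = false)]%N by split; apply/eqP; lia.
rewrite ?e1 ?e2 ?e3 !andbF !mul0r !mul0rn !add0r mul0rn subr0 bin0 mulr1 -!mulrnA.
by rewrite !eqSS (inj_eq double_inj).
Qed.

Lemma dual_form_diag : {in basis_index m, forall i, dual_form i (basis_vec i) != 0}.
Proof.
case=> [k [[a b] c]]; rewrite mem_basis_index.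
have one : 1 != 0 :> K by rewrite oner_eq0.
case: k => [|[|[|[|[|[|[|//]]]]]]] /= lt_m.
- by rewrite coordE ?eqxx //; lia.
- by rewrite coordE ?eqxx //; lia.
- by rewrite coordE ?eqxx //; lia.
- by rewrite coordE ?eqxx //; lia.
- by rewrite coordE ?eqxx //; lia.
- rewrite coord_adX ?eqxx; last by lia.
  rewrite [(a.*2, b.*2, _)%N == _](_ : _ = false) ?mul0rn ?subr0 -?mulrnA ?pnatr_eq0 //.
  by apply/eqP => -[]; lia.
- rewrite rotation_form_adZ //; last by lia.
  rewrite !eqxx pnatr_eq0 muln_eq0 negb_or; lia.
Qed.

Lemma coord_even p q r : (p + q + r <= n)%N -> odd p || odd q ->
  forall p' q' r', odd p' = false -> odd q' = false -> odd r' = false ->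
  coord (p, q, r) (x p' q' r') = 0.
Proof.
move=> le_n pq_odd p' q' r' p'_even q'_even _; rewrite coordE //.
by case: eqP pq_odd => // -[<- <- _]; rewrite p'_even q'_even.
Qed.

Lemma coord_adX_neq0 p q r a b c : (p + q + r <= n)%N ->
  coord (p, q, r) (adX (x a.*2 b.*2.+1 c.*2.+1)) != 0 ->
  [/\ a.*2 = p, b.*2.+2 = q & c.*2 = r] \/ [/\ a.*2 = p, b.*2 = q & c.*2.+2 = r].
Proof.
move=> le_n; rewrite coord_adX //.
have [[-> -> ->]|_] := eqVneq (a.*2, b.*2.+2, c.*2)%N _; first by left.
have [[-> -> ->]|_] := eqVneq (a.*2, b.*2, c.*2.+2)%N _; first by right.
by rewrite !mul0rn subrr mul0rn eqxx.
Qed.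

Lemma rotation_form_neq P s p q r : (P + s.*2 <= n)%N -> p != P ->
  rotation_form P s (x p q r) = 0.
Proof.
move=> le_n neq_p; apply: big1 => j _; rewrite coordE; last by have := ltn_ord j; lia.
by rewrite !xpair_eqE (negPf neq_p) mul0r.
Qed.

(** Parity separates tags 0 to 2 from the rest, whose symbols have only even exponents. Rotation
    forms kill L_1, and also Z^2 and Y^2 because their first exponent is positive. Leaving out
    (0,0,0) from tag 5 separates L_1 from Z^2 and Y^2. *)
Lemma dual_form_triangular : {in basis_index m &, forall i j, i != j ->
  dual_form i (basis_vec j) != 0 -> (elim_rank j < elim_rank i)%N}.
Proof.
case=> [k [[a b] c]] [k' [[a' b'] c']]; rewrite !mem_basis_index.
have even_coord (p q r : nat) (u : V) : (p + q + r <= n)%N -> odd p || odd q ->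
    (forall f : V -> K^o, linear f ->
      (forall p q r, odd p = false -> odd q = false -> odd r = false -> f (x p q r) = 0)
      -> f u = 0) -> coord (p, q, r) u = 0.
  by move=> le_n odd_pq; apply; [exact: linearP | exact: coord_even].
case: k => [|[|[|[|[|[|[|//]]]]]]];
  case: k' => [|[|[|[|[|[|[|//]]]]]]];
  rewrite /elim_rank ?xpair_eqE ?eqxx /dual_form /basis_vec;
  move=> lt_m lt_m' neq nz; rewrite /=;
  try lia;
  try by [have [|e1 e2 e3] := coord_neq0 _ nz; lia];
  try by [have [|[e1 e2 e3]|[e1 e2 e3]] := coord_adX_neq0 _ nz; lia];
  try by [case/eqP: nz; apply: even_coord => [||f ? ?];
     rewrite /= ?double_even ?orbT //;
     [lia | exact: even_adX]];
  try by [case/eqP: nz; apply: even_coord => [||f ? ?];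
     rewrite /= ?double_even ?orbT //;
     [lia | exact: even_adZ]];
  try by [case/eqP: nz; rewrite -doubleS rotation_form_odd //=
     ?double_even ?orbT //; lia];
  try by [case/eqP: nz; rewrite rotation_form_neq //; lia];
  try by [case/eqP: nz; rewrite rotation_form_adX //; lia].
(* What remains is a pair of L_2 vectors: the form with s = c vanishes on every other one with c' >=
   c. *)
rewrite ltnNge; apply/negP => le_c; case/eqP: nz.
rewrite rotation_form_adZ //; last by lia.
rewrite (_ : _ && _ = false) ?mul0rn //; lia.
Qed.

Lemma basis_seq_free : free basis_seq.
Proof.
exact: (free_triangular (basis_index_uniq m) dual_form_linear dual_form_diag
  dual_form_triangular).
Qed.

End Combinatorics.

(** * The Lie algebra *)

Section LieStable.
Variables (R : realType) (N : nat).
Implicit Types (A B D : Defs.realmx R N) (W : {vspace Defs.realmx R N}).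

Lemma lie_jacobi A B D : lie (lie A B) D = lie A (lie B D) - lie B (lie A D).
Proof.
have aux (G : zmodType) (a b c d : G) : a - b - (c - d) = a + d - (b + c).
  by rewrite opprB addrACA -opprD.
(* In order, the variables stand for the words abd, adb, bda, dba, bad and dab. *)
have expand (G : zmodType) (u v w z s t : G) :
    u - s - (t - z) = u - v - (w - z) - (s - w - (v - t)).
  rewrite (aux _ u s) (aux _ u v) (aux _ s w) (addrC w v).
  by rewrite opprB addrA subrK.
have ring_jacobi (S : pzRingType) (a b d : S) :
    (a * b - b * a) * d - d * (a * b - b * a) =
    (a * (b * d - d * b) - (b * d - d * b) * a)
    - (b * (a * d - d * a) - (a * d - d * a) * b).
  by rewrite !mulrBl !mulrBr !mulrA; apply: expand.
exact: ring_jacobi.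
Qed.

(* The elements of [W] normalizing [W] form a Lie algebra by the Jacobi
   identity, so it suffices to check that the generators normalize [W]. *)
Lemma lie_closure_sub (X : seq (Defs.realmx R N)) W :
  {subset X <= W} -> (forall A B, A \in X -> B \in W -> lie A B \in W) ->
  (lie_closure X <= W)%VS.
Proof.
move=> XW Xnorm; case: (lie_closureP X) => _ _ minX.
(* The normalizing elements are cut out by finitely many linear conditions, one for each basis
   vector of [W]. *)
pose U := (W :&: \bigcap_(i < \dim W) (linfun (lier (vbasis W)`_i) @^-1: W))%VS.
have memU A : A \in U <-> A \in W /\ forall B, B \in W -> lie A B \in W.
  rewrite memv_cap; split=> [/andP[WA] | [WA normA]].
    rewrite memvE => /subv_bigcapP normA; split=> // B WB.
    rewrite (coord_vbasis WB) linear_sum; apply: memv_suml => i _.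
    rewrite linearZ memvZ //.
    by have := normA i isT; rewrite -memvE -memv_preim lfunE.
  rewrite WA memvE; apply/subv_bigcapP => i _.
  rewrite -memvE -memv_preim lfunE; apply: normA.
  by apply: vbasis_mem; rewrite mem_nth ?size_tuple.
have subUW : (U <= W)%VS by apply: capvSl.
apply: subv_trans subUW; apply: minX => [A XA | A B /memU[WA nA] /memU[WB nB]].
  by apply/memU; split=> [|B]; [apply: XW | apply: Xnorm].
apply/memU; split=> [|D WD]; first exact: nA.
by rewrite lie_jacobi rpredB ?nA ?nB ?nA.
Qed.

End LieStable.

Local Open Scope classical_set_scope.
Local Open Scope ring_scope.

(** * Basis and dimension for the complete graph on 2m vertices *)

Section Main.
Variables (R : realType) (m : nat).
Hypothesis m_gt0 : (0 < m)%N.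
Local Notation n := m.*2.
Local Notation XYZ := (XYZ R n).
Local Notation adX := (lie (XYZ 1 0 0)).
Local Notation adZ := (lie (XYZ 0 0 2)).

Let n_gt0 : (0 < n)%N. Proof. by rewrite double_gt0. Qed.

Definition dla_seq := basis_seq XYZ adX adZ m.

Let adXE := @lie_X R n.
Let adZE p q r := @lie_ZZ R n p q r n_gt0.
Let coordE p q r p' q' r' := @coordXYZE R n p q r p' q' r'.

Lemma dla_seq_basis : basis_of (dla_complete R n) dla_seq.
Proof.
have X0 := @XYZ0 R n.
rewrite /basis_of; apply/andP; split; last first.
  exact: (basis_seq_free adXE adZE m_gt0 erefl coordE).
rewrite /dla_complete mixerE // phase_separatorE // eqEsubv; apply/andP; split.
  have [gen stab _] := lie_closureP [:: XYZ 1 0 0; XYZ 0 0 2].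
  have g1 : XYZ 1 0 0 \in lie_closure [:: XYZ 1 0 0; XYZ 0 0 2].
    by apply: gen; rewrite inE eqxx.
  have g2 : XYZ 0 0 2 \in lie_closure [:: XYZ 1 0 0; XYZ 0 0 2].
    by apply: gen; rewrite !inE eqxx orbT.
  apply/span_subvP; apply: (basis_seq_stable X0 adXE adZE erefl) => // v gv.
    exact: stab.
  exact: stab.
rewrite /dla_seq.
apply: lie_closure_sub => [A | A B]; rewrite !inE => /orP[]/eqP->.
- exact: (@span_good _ _ _ XYZ adX adZ X0 m m_gt0 erefl 1 0 0).
- exact: (span_002 XYZ adX adZ m).
- exact: (span_adX_stable X0 adXE adZE m_gt0 erefl).
- exact: (span_adZ_stable X0 adXE adZE m_gt0 erefl).
Qed.

Lemma basis_vec_dla_seq i : i \in basis_index m -> basis_vec XYZ adX adZ i \in dla_seq.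
Proof. exact: map_f. Qed.

(** [J1] removes a matrix, not an index, so other indices must be shown to give other matrices; the
    coordinates distinguish them. *)
Lemma XYZ_neq011 p q r : (p + q + r <= n)%N -> (p, q, r) != (0, 1, 1)%N ->
  XYZ p q r <> XYZ 0 1 1.
Proof.
move=> le_n neq eqXYZ; have := @coordE p q r p q r le_n.
rewrite eqXYZ coordE // eqxx eq_sym (negPf neq) => /eqP.
by rewrite eq_sym oner_eq0.
Qed.

Lemma halfE p : p = (odd p + p./2.*2)%N. Proof. by rewrite odd_double_half. Qed.

(** Tag 0 is [J1] together with Y^1 Z^1, which [J5] puts back; tag 2 is [J2] for q = 1 and [J3] for
    q >= 3. *)
Lemma dla_seqE : J1 R n `|` J2 R n `|` J3 R n `|` J4 R n `|` J5 R n `|` L1 R n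
  `|` L2 R n = [set` dla_seq].
Proof.
have J1in p q r : (p + q + r <= n)%N -> [&& ~~ odd p, odd q & odd r] ->
    exists a b c, [/\ (a + b + c < m)%N & XYZ p q r = XYZ a.*2 b.*2.+1 c.*2.+1
      /\ (p, q, r) = (a.*2, b.*2.+1, c.*2.+1)].
  move=> le_n /and3P[/negPf po qo ro]; exists p./2, q./2, r./2.
  have := halfE p; have := halfE q; have := halfE r; rewrite po qo ro add0n !add1n.
  by move=> <- <- <-; split=> //; lia.
apply/seteqP; split => A /=.
- case=> [[[[[[]|]|]|]|]|].
  + move=> [[p [q [r [le_n /J1in-/(_ le_n)]]]]] [a [b [c [lt_m [-> _]]]]] -> _.
    by apply: (@basis_vec_dla_seq (0, (a, b, c))%N); rewrite mem_basis_index.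
  + move=> [p [q [r [le_n /and3P[po /eqP q1 ro] ->]]]].
    have := halfE p; have := halfE r; rewrite po ro q1 !add1n => er ep.
    rewrite er ep; apply: (@basis_vec_dla_seq (2, (p./2, 0, r./2))%N).
    by rewrite mem_basis_index; lia.
  + move=> [p [q [r [le_n /and4P[po qo ro q3] ->]]]].
    have := halfE p; have := halfE q; have := halfE r.
    rewrite po qo ro !add1n => er eq ep.
    rewrite er eq ep; apply: (@basis_vec_dla_seq (2, (p./2, q./2, r./2))%N).
    by rewrite mem_basis_index; lia.
  + move=> [p [q [r [le_n /and3P[po /negPf qo /negPf ro] ->]]]].
    have := halfE p; have := halfE q; have := halfE r.
    rewrite po qo ro !add1n !add0n => er eq ep.
    rewrite er eq ep; apply: (@basis_vec_dla_seq (1, (p./2, q./2, r./2))%N).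
    by rewrite mem_basis_index; lia.
  + case=> [[->|->]|->].
    * by apply: (@basis_vec_dla_seq (3, (0, 0, 0))%N); rewrite mem_basis_index.
    * by apply: (@basis_vec_dla_seq (4, (0, 0, 0))%N); rewrite mem_basis_index.
    * by apply: (@basis_vec_dla_seq (0, (0, 0, 0))%N); rewrite mem_basis_index.
  + move=> [v [[p [q [r [le_n par ->]]]] neq] <-].
    have [a [b [c [lt_m [eqv _]]]]] := J1in p q r le_n par; rewrite eqv in neq *.
    apply: (@basis_vec_dla_seq (5, (a, b, c))%N); rewrite mem_basis_index lt_m andbT.
    by apply: contra_notN neq => /eqP[-> -> ->].
  + move=> [v [p [q [r [le_n /and3P[po /eqP q1 ro] ->]]]] <-].
    have := halfE p; have := halfE r; rewrite po ro q1 !add1n => er ep.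
    rewrite er ep; apply: (@basis_vec_dla_seq (6, (p./2, 0, r./2))%N).
    by rewrite mem_basis_index; lia.
- have inJ1 a b c : (a, b, c) != (0, 0, 0)%N -> (a + b + c < m)%N ->
      J1 R n (XYZ a.*2 b.*2.+1 c.*2.+1).
    move=> neq lt_m; split.
      exists a.*2, b.*2.+1, c.*2.+1; rewrite /= !odd_double; split=> //; lia.
    apply: XYZ_neq011; first by lia.
    by apply: contra neq => /eqP[]; rewrite !xpair_eqE; lia.
  have inJ2 a c : (a + c < m.-1)%N -> J2 R n (XYZ a.*2.+1 1 c.*2.+1).
    move=> lt_m; exists a.*2.+1, 1%N, c.*2.+1; rewrite /= !odd_double; split=> //; lia.
  move=> /mapP[[k [[a b] c]]]; rewrite mem_basis_index.
  case: k => [|[|[|[|[|[|[|//]]]]]]] /=.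
  + move=> lt_m ->; have [[-> -> ->]|neq] := eqVneq (a, b, c) (0, 0, 0)%N.
      by left; left; right; right.
    by do 6 left; apply: inJ1.
  + move=> lt_m ->; do 3 left; right; exists a.*2.+1, b.*2, c.*2.
    by rewrite /= !odd_double; split=> //; lia.
  + move=> lt_m ->; case: b lt_m => [|b] lt_m.
      by do 5 left; right; apply: inJ2; lia.
    do 4 left; right; exists a.*2.+1, b.+1.*2.+1, c.*2.+1.
    by rewrite /= !odd_double; split=> //; lia.
  + by move=> _ ->; left; left; right; left; left.
  + by move=> _ ->; left; left; right; left; right.
  + move=> /andP[neq lt_m] ->; left; right; exists (XYZ a.*2 b.*2.+1 c.*2.+1) => //.
    exact: inJ1.
  + move=> /andP[_ lt_m] ->; right; exists (XYZ a.*2.+1 1 c.*2.+1) => //.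
    exact: inJ2.
Qed.

(** The factor 12 keeps the count in [nat] and absorbs the denominators 6 and 2 of the simplex
    sizes. *)
Lemma size_dla_seq : (12 * size dla_seq = n ^ 3 + 6 * n ^ 2 + 2 * n + 12)%N.
Proof.
rewrite size_map size_basis_index //.
case: m m_gt0 => // k _ /=.
have s3 := size_simplex3 k.+1; have s3' := size_simplex3 k; have s2 := size_simplex2 k.
have -> : (12 * (3 * size (simplex3 k.+1) + size (simplex3 k) + size (simplex2 k) + 1)
  = 6 * (6 * size (simplex3 k.+1)) + 2 * (6 * size (simplex3 k))
    + 6 * (2 * size (simplex2 k)) + 12)%N by lia.
by rewrite s3 s3' s2 -muln2; lia.
Qed.

End Main.

Lemma natr_cubic (a b c d k l : nat) : (a * k = l ^ 3 + b * l ^ 2 + c * l + d)%N ->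
  a%:R * k%:R = l%:R ^+ 3 + b%:R * l%:R ^+ 2 + c%:R * l%:R + d%:R :> rat.
Proof.
by rewrite -natrM => ->; rewrite !natrD natrX (natrM _ b) (natrM _ c) natrX.
Qed.

Theorem theorem39 (R : realType) (n : nat)
    (n_ge2 : (2 <= n)%N) (n_even : ~~ odd n) :
  basis_set (dla_complete R n)
    (J1 R n `|` J2 R n `|` J3 R n `|` J4 R n `|` J5 R n `|` L1 R n `|` L2 R n)
  /\ (\dim (dla_complete R n))%:R
     = 1 / 12 * (n%:R ^+ 3 + 6 * n%:R ^+ 2 + 2 * n%:R + 12) :> rat.
Proof.
have n_m : n = n./2.*2 by rewrite -[LHS]odd_double_half (negPf n_even).
have m_gt0 : (0 < n./2)%N by lia.
move: (n./2) m_gt0 n_m => m m_gt0 -> {n n_ge2 n_even}.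
have basis := dla_seq_basis R m_gt0.
split; first by exists (dla_seq R m) => //; exact: dla_seqE.
have /andP[/eqP <- /eqP ->] := basis.
have <- := natr_cubic (size_dla_seq R m_gt0).
by rewrite mul1r mulKf // pnatr_eq0.
Qed.
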